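(* Let $\mathbb{F}$ be a field and let $\mathcal{M}$ be a class of $\mathbb{F}$-representable matroids. Then there is an integer $k$ such that every matroid in $\mathcal{M}$ has branch-depth at most $k$ if and only if there exist an integer $d$ and a class $\mathcal{N}$ of $\mathbb{F}$-representable matroids, each of contraction-deletion-depth at most $d$, such that every matroid in $\mathcal{M}$ is a minor of some matroid in $\mathcal{N}$.
   Context: For a matroid $M$ with rank function $r_M$ and disjoint sets $X,Y$ of elements, $\lambda_M(X,Y)=r_M(X)+r_M(Y)-r_M(X\cup Y)$. For pairwise disjoint sets $X_1,\dots,X_k$ of elements, $\lambda^*_M(X_1,\dots,X_k)=\max_{I\subseteq[k]}\lambda_M\big(\bigcup_{i\in I}X_i,\bigcup_{i\in[k]\setminus I}X_i\big)$. A $(d,r)$-decomposition of a matroid $M$ is a tree $T$ of radius $d$ whose leaves are in one-to-one correspondence with the elements of $M$, such that for every inner (non-leaf) vertex $v$ of $T$ with $k$ neighbours, if $X_1,\dots,X_k$ are the sets of elements of $M$ assigned to the leaves of the $k$ components of $T\setminus v$, then $\lambda^*_M(X_1,\dots,X_k)\le r$. The branch-depth $\mathrm{bd}(M)$ is the minimum $k$ such that $M$ has a $(d,r)$-decomposition with $d\le k$ and $r\le k$. The contraction-deletion-depth $\mathrm{cdd}(M)$ is defined recursively: if $M$ has a single element, $\mathrm{cdd}(M)=1$; if $M$ is not connected, $\mathrm{cdd}(M)$ is the maximum of $\mathrm{cdd}$ over the components of $M$ (restrictions of $M$ to its components, a component being an inclusion-wise maximal set of elements any two of which lie in a common circuit);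 otherwise $\mathrm{cdd}(M)=1+\min_{e}\min\{\mathrm{cdd}(M/e),\mathrm{cdd}(M\setminus e)\}$, the minimum over elements $e$ of $M$. *)

(* Defs.v *)
From HB Require Import structures.
From mathcomp Require Import all_boot all_order all_algebra.
Set Implicit Arguments. Unset Strict Implicit. Unset Printing Implicit Defensive.
Import GRing.Theory.

Definition rank_axioms (T : finType) (r : {set T} -> nat) : Prop :=
  [/\ forall X : {set T}, r X <= #|X|,
      forall X Y : {set T}, X \subset Y -> r X <= r Y
    & forall X Y : {set T}, r (X :|: Y) + r (X :&: Y) <= r X + r Y].

Record matroid := Matroid {
  elt : finType;
  rk : {set elt} -> nat;
  rk_ax : rank_axioms rk }.
Arguments rk : clear implicits.

Definition representable (F : fieldType) (M : matroid) : Prop :=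
  exists (m : nat) (v : elt M -> 'rV[F]_m),
    forall X : {set elt M}, rk M X = \dim <<[seq v x | x <- enum X]>>%VS.

(* M is (isomorphic to) a minor of N: M = N / C \ D, up to relabelling. *)
Definition is_minor (M N : matroid) : Prop :=
  exists (f : elt M -> elt N) (C : {set elt N}),
    [/\ injective f, [disjoint C & f @: [set: elt M]]
      & forall X : {set elt M}, rk M X = rk N (f @: X :|: C) - rk N C].

Definition lambda (T : finType) (r : {set T} -> nat) (X Y : {set T}) : nat :=
  r X + r Y - r (X :|: Y).

Definition lambda_star (T I : finType) (r : {set T} -> nat)
    (X : I -> {set T}) : nat :=
  \max_(J : {set I})
     lambda r (\bigcup_(i in J) X i) (\bigcup_(i in ~: J) X i).

Definition remove_edge (V : finType) (e : rel V) (a b : V) : rel V :=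
  [rel x y | e x y && ~~ ((x == a) && (y == b)) && ~~ ((x == b) && (y == a))].

Definition is_tree (V : finType) (e : rel V) : Prop :=
  [/\ 0 < #|V|, symmetric e, irreflexive e,
      forall x y : V, connect e x y
    & forall a b : V, e a b -> ~~ connect (remove_edge e a b) a b].

Definition degree (V : finType) (e : rel V) (v : V) : nat := #|[set u | e v u]|.

Definition leaf (V : finType) (e : rel V) (v : V) : bool := degree e v <= 1.

Definition radius_le (V : finType) (e : rel V) (d : nat) : Prop :=
  exists c : V, forall w : V,
    exists p : seq V, [/\ path e c p, last c p = w & size p <= d].

Definition delete_vertex (V : finType) (e : rel V) (v : V) : rel V :=
  [rel x y | e x y && (x != v) && (y != v)].

Definition nbr (V : finType) (e : rel V) (v : V) := {u : V | e v u}.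

Definition comp_elts (M : matroid) (V : finType) (e : rel V) (f : elt M -> V)
    (v : V) (u : nbr e v) : {set elt M} :=
  [set x | connect (delete_vertex e v) (val u) (f x)].

(* (d, r)-decomposition, with "radius d" read as "radius at most d" *)
Definition decomposition (M : matroid) (d r : nat) : Prop :=
  exists (V : finType) (e : rel V) (f : elt M -> V),
    [/\ is_tree e, radius_le e d, injective f,
        (forall w : V, leaf e w = (w \in codom f))
      & forall v : V, ~~ leaf e v ->
          lambda_star (rk M) (@comp_elts M V e f v) <= r].

Definition bd_le (M : matroid) (k : nat) : Prop :=
  exists d r, [/\ d <= k, r <= k & decomposition M d r].

(* We work with a rank function r on a type T, restricted to a ground set S. *)

Definition is_circuit (T : finType) (r : {set T} -> nat) (C : {set T}) : bool :=
  (r C < #|C|) && [forall x in C, r (C :\ x) == #|C :\ x|].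

Definition common_circuit (T : finType) (r : {set T} -> nat) (S : {set T})
    (x y : T) : Prop :=
  exists C : {set T}, [/\ C \subset S, is_circuit r C, x \in C & y \in C].

Definition circ_linked (T : finType) (r : {set T} -> nat) (S X : {set T}) : Prop :=
  forall x y, x \in X -> y \in X -> x != y -> common_circuit r S x y.

Definition component (T : finType) (r : {set T} -> nat) (S C : {set T}) : Prop :=
  [/\ C \subset S, circ_linked r S C
    & forall D : {set T}, C \proper D -> D \subset S -> ~ circ_linked r S D].

Definition connected_m (T : finType) (r : {set T} -> nat) (S : {set T}) : Prop :=
  circ_linked r S S.

Definition contract (T : finType) (r : {set T} -> nat) (a : T) : {set T} -> nat :=
  fun X => r (X :|: [set a]) - r [set a].

Inductive cdd_le (T : finType) : ({set T} -> nat) -> {set T} -> nat -> Prop :=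
| cdd_single r S d (x : T) : S = [set x] -> 1 <= d -> cdd_le r S d
| cdd_disconn r S d : ~ connected_m r S ->
    (forall C, component r S C -> cdd_le r C d) -> cdd_le r S d
| cdd_conn r S d (a : T) : S <> [set a] -> connected_m r S -> a \in S ->
    (cdd_le (contract r a) (S :\ a) d \/ cdd_le r (S :\ a) d) ->
    cdd_le r S d.+1.

Definition cdd_at_most (M : matroid) (d : nat) : Prop :=
  cdd_le (rk M) [set: elt M] d.

(* Main.v *)
(** A branch-decomposition of bounded radius and width is the same thing as a
    bounded chain of refining partitions ([layout] below), and layouts pass to
    minors.  A matroid of small contraction-deletion-depth has a layout obtained
    by splitting alternately into components and off single elements.

    Conversely, represent [M] by a basis [B] and its fundamental matrix [A].  The
    connectivity of a set bounds the rank of the corresponding off-diagonal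
    block of [A], and a matrix whose off-diagonal ranks are all bounded is block
    diagonal up to a matrix of bounded rank.  Recursing into the blocks writes
    [A] as a sum of rank-one matrices [u k * w k] organised in a shallow tree.
    Introducing for every [k] a new coordinate, the corresponding basis vector,
    and an element whose contraction identifies that coordinate with [w k],
    exhibits [M] as a minor of a matroid that falls apart along the tree when
    the new elements of each node are contracted or deleted. *)
Require Import Defs.
From HB Require Import structures.
From mathcomp Require Import all_boot all_order all_algebra.
From mathcomp Require Import zify.
Set Implicit Arguments. Unset Strict Implicit. Unset Printing Implicit Defensive.

(** * Connectivity of rank functions *)

(** The two elements added for a rank-one term [k] play opposite roles in the two halves of the
    argument. One is the unit vector [e_k] of the new coordinate, the other is [w k - e_k]. To
    recover [M], the second is contracted and the first deleted. To take the large matroid apart,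
    the first is contracted, which erases the coordinate that the vectors [u k] share, and the
    second is deleted. Each rank-one term therefore costs two units of contraction-deletion-depth.

    Bounding every union of sibling subtrees, not only single subtrees, is essential: it controls
    all cuts between the classes of one level, so the matrix argument can pivot and induct on the
    rank. A fundamental matrix is used because its rows and columns are both indexed by elements, so
    that a set of elements cuts out a block.

    The definitions speak of circuits while all estimates are about ranks. The classical equivalence
    of circuit connectivity and the absence of separations is therefore proved first. *)

Ltac sets_at x :=
  repeat match goal with
  | H : is_true (_ \subset _) |- _ => revert H; move/subsetP/(_ x)
  | H : is_true [disjoint _ & _] |- _ => revert H; rewrite disjoint_subset; move/subsetP/(_ x)
  | H : is_true (_ \in _) |- _ => revert H
  | H : is_true (_ \notin _) |- _ => revert H
  end;
  rewrite ?inE;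
  repeat match goal with
  | |- context [x == ?a] => case: (eqVneq x a) => [->|?]
  end;
  repeat match goal with
  | |- context [?y \in ?A] => case: (y \in A)
  end; 
  try solve [rewrite //=; intros;
    repeat match goal with H : is_true true -> _ |- _ => specialize (H isT) end;
    done].

Ltac sets :=
  match goal with
  | |- is_true (_ \subset _) => let x := fresh "x" in apply/subsetP => x; sets_at x
  | |- _ = _ => let x := fresh "x" in apply/setP => x; sets_at x
  end.

Section RankFunction.
Variables (T : finType) (r : {set T} -> nat).
Hypothesis rax : rank_axioms r.
Implicit Types (S A B C X Y : {set T}) (x y a e : T).

Lemma rk_le_card X : r X <= #|X|.
Proof. by case: rax. Qed.

Lemma rk_mono X Y : X \subset Y -> r X <= r Y.
Proof. by case: rax => _ h _; apply: h. Qed.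

Lemma rk_submod X Y : r (X :|: Y) + r (X :&: Y) <= r X + r Y.
Proof. by case: rax. Qed.

Lemma rk0 : r set0 = 0.
Proof. by have := rk_le_card set0; rewrite cards0; lia. Qed.

Lemma rk1_le a : r [set a] <= 1.
Proof. by have := rk_le_card [set a]; rewrite cards1. Qed.

Lemma rkU_le X Y : r (X :|: Y) <= r X + r Y.
Proof. by have := rk_submod X Y; lia. Qed.

Lemma rkD_le X Y : r X <= r Y + r (X :\: Y).
Proof.
apply: leq_trans (rkU_le _ _); apply: rk_mono; sets.
Qed.

Lemma rk_indep_sub X Y : r X = #|X| -> Y \subset X -> r Y = #|Y|.
Proof.
move=> rX sYX; have h1 := rkD_le X Y; have h2 := rk_le_card (X :\: Y).
have h3 := rk_le_card Y; have := cardsID Y X.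
by rewrite (setIidPr sYX); lia.
Qed.

(** Submodularity is used twice, to grow [Y'] to [Y] and then [X'] to [X]. The inequality is kept
    additive because [lambda] truncates its subtraction. *)
Lemma lambda_mono X Y X' Y' : X' \subset X -> Y' \subset Y ->
  r X' + r Y' + r (X :|: Y) <= r X + r Y + r (X' :|: Y').
Proof.
move=> sX sY.
have h1 := rk_submod X (X' :|: Y); have h2 := rk_submod Y (X' :|: Y').
have h3 : r X' <= r (X :&: (X' :|: Y)) by apply: rk_mono; sets.
have h4 : r Y' <= r (Y :&: (X' :|: Y')) by apply: rk_mono; sets.
have e1 : X :|: (X' :|: Y) = X :|: Y by sets.
have e2 : Y :|: (X' :|: Y') = X' :|: Y by sets.
by rewrite e1 in h1; rewrite e2 in h2; lia.
Qed.

Lemma lambdaE_mono X Y X' Y' : X' \subset X -> Y' \subset Y ->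
  lambda r X' Y' <= lambda r X Y.
Proof.
move=> sX sY; have := lambda_mono sX sY; rewrite /lambda.
by have := rkU_le X' Y'; have := rkU_le X Y; lia.
Qed.

Lemma lambdaC X Y : lambda r X Y = lambda r Y X.
Proof. by rewrite /lambda setUC addnC. Qed.

Lemma lambda_le_card X Y : lambda r X Y <= #|X|.
Proof.
rewrite /lambda; have := rk_le_card X.
by have := rk_mono (subsetUr X Y); lia.
Qed.

(** Such an [A] is a direct summand of the restriction to [S], in other words a union of
    components. *)
Definition sep S A := (A \subset S) && (r A + r (S :\: A) == r S).

Lemma sep_sub S A : sep S A -> A \subset S.
Proof. by case/andP. Qed.

Lemma sepE S A : sep S A -> r A + r (S :\: A) = r S.
Proof. by case/andP => _ /eqP. Qed.

Lemma sep_le S A : A \subset S -> r A + r (S :\: A) <= r S -> sep S A.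
Proof. by move=> sA h; rewrite /sep sA; have := rkD_le S A; lia. Qed.

Lemma sep_full S : sep S S.
Proof. by rewrite /sep subxx setDv rk0 addn0 eqxx. Qed.

Lemma sepC S A : sep S A -> sep S (S :\: A).
Proof.
case/andP=> sA /eqP h; apply: sep_le; first exact: subsetDl.
have -> : S :\: (S :\: A) = A by sets.
by rewrite addnC h.
Qed.

Lemma sep_IU S A B : sep S A -> sep S B -> sep S (A :&: B) /\ sep S (A :|: B).
Proof.
case/andP=> sA /eqP hA /andP[sB /eqP hB].
have sI : A :&: B \subset S by sets.
have sU : A :|: B \subset S by sets.
have h1 := rk_submod A B; have h2 := rk_submod (S :\: A) (S :\: B).
have h3 := rkD_le S (A :&: B); have h4 := rkD_le S (A :|: B).
rewrite -setDIr -setDUr in h2.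
by split; apply: sep_le => //; lia.
Qed.

Lemma sepI S A B : sep S A -> sep S B -> sep S (A :&: B).
Proof. by move=> hA /(sep_IU hA)[]. Qed.

Lemma sepU S A B : sep S A -> sep S B -> sep S (A :|: B).
Proof. by move=> hA /(sep_IU hA)[]. Qed.

Lemma sep_restr S A X : sep S A -> X \subset S -> sep X (X :&: A).
Proof.
case/andP=> sA /eqP hA sX; apply: sep_le; first exact: subsetIl.
have s1 : X :&: A \subset A by sets.
have s2 : X :\: (X :&: A) \subset S :\: A by sets.
have := lambda_mono s1 s2.
have -> : A :|: (S :\: A) = S by sets.
have -> : (X :&: A) :|: (X :\: (X :&: A)) = X by sets.
by lia.
Qed.

Lemma sep_trans S A B : sep S A -> sep A B -> sep S B.
Proof.
case/andP=> sA /eqP hA /andP[sB /eqP hB]; apply: sep_le; first by sets.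
have := rkD_le (S :\: B) (A :\: B).
have -> : (S :\: B) :\: (A :\: B) = S :\: A by sets.
by lia.
Qed.

Definition sconn S := [forall A : {set T}, sep S A ==> (A == set0) || (A == S)].

Lemma sconnP S :
  reflect (forall A, sep S A -> A = set0 \/ A = S) (sconn S).
Proof.
apply: (iffP forallP) => h A.
  by move=> hA; move: (h A); rewrite hA => /orP[/eqP|/eqP]; [left|right].
by apply/implyP => /h[] ->; rewrite eqxx ?orbT.
Qed.

Lemma sconnPn S : ~~ sconn S -> exists A, [/\ sep S A, A != set0 & S :\: A != set0].
Proof.
rewrite negb_forall => /existsP[A]; rewrite negb_imply negb_or => /and3P[hA h0 h1].
exists A; split=> //; apply: contra h1; rewrite setD_eq0 => sA.
by rewrite eqEsubset sA (sep_sub hA).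
Qed.

(** If [K] had elements on both sides, [K :&: A] and [K :\: A] would be independent with ranks
    adding up to [r K], so [K] would be independent. *)
Lemma circuit_sep S A K : is_circuit r K -> K \subset S -> sep S A ->
  K :&: A != set0 -> K \subset A.
Proof.
move=> /andP[dK /forallP iK] sK hA /set0Pn[x]; rewrite inE => /andP[xK xA].
apply: contraLR dK => /subsetPn[y yK yA]; rewrite -leqNgt.
have ind z : z \in K -> r (K :\ z) = #|K :\ z|.
  by move=> zK; apply/eqP; move: (iK z); rewrite zK.
have h1 : r (K :&: A) = #|K :&: A|.
  by apply: rk_indep_sub (ind y yK) _; sets.
have h2 : r (K :\: A) = #|K :\: A|.
  by apply: rk_indep_sub (ind x xK) _; sets.
have := sepE (sep_restr hA sK).
have -> : K :\: (K :&: A) = K :\: A by sets.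
by rewrite h1 h2 cardsID => ->.
Qed.

(** The component of [x]: separations are closed under intersection, so a smallest one containing
    [x] lies in every other. *)
Definition cmp S x := [arg min_(A < S | sep S A && (x \in A)) #|A|].

Lemma cmpP S x : x \in S ->
  [/\ sep S (cmp S x), x \in cmp S x
    & forall B, sep S B -> x \in B -> cmp S x \subset B].
Proof.
move=> xS; rewrite /cmp; case: arg_minnP => [|A /andP[hA xA] mA].
  by rewrite sep_full.
split=> // B hB xB; have := mA (A :&: B); rewrite sepI // inE xA xB => /(_ isT).
move=> le; have : A :&: B == A by rewrite eqEcard subsetIl.
by move/eqP/setIidPl.
Qed.

Lemma cmp_sconn S x : x \in S -> sconn (cmp S x).
Proof.
case/cmpP => hC xC mC; apply/sconnP => A hA.
have [xA|xA] := boolP (x \in A).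
  right; apply/eqP; rewrite eqEsubset (sep_sub hA).
  exact: mC (sep_trans hC hA) xA.
left; have := mC _ (sep_trans hC (sepC hA)); rewrite inE xA xC => /(_ isT).
have := sep_sub hA => s1 s2; sets.
Qed.

Lemma sconn_sep_cmp S C x : sep S C -> sconn C -> x \in C -> C = cmp S x.
Proof.
move=> hC /sconnP cC xC; have xS := subsetP (sep_sub hC) x xC.
have [hD xD mD] := cmpP xS.
have sDC := mD C hC xC.
have := sep_restr hD (sep_sub hC); rewrite (setIidPr sDC).
by case/cC => // e; move: xD; rewrite e inE.
Qed.

Lemma contract_rank_axioms a : rank_axioms (contract r a).
Proof.
rewrite /contract; split=> [X|X Y sXY|X Y].
- by have := rkU_le X [set a]; have := rk_le_card X; lia.
- have : r (X :|: [set a]) <= r (Y :|: [set a]) by apply/rk_mono/setSU.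
  by lia.
have := rk_submod (X :|: [set a]) (Y :|: [set a]).
rewrite -setUIl -setUUl.
have h Z : r [set a] <= r (Z :|: [set a]) by apply: rk_mono; sets.
by have := h X; have := h Y; have := h (X :&: Y); have := h (X :|: Y); lia.
Qed.

Lemma contractE a X : contract r a X + r [set a] = r (X :|: [set a]).
Proof. by rewrite /contract subnK //; apply: rk_mono; sets. Qed.

End RankFunction.

(** * Connectedness by circuits and by separations *)

Section Connectivity.
Variable T : finType.
Implicit Types (r : {set T} -> nat) (S A C D K X Y Z : {set T}).

Lemma eq_sep r r' S A : {in [pred X : {set T} | X \subset S], r =1 r'} ->
  sep r S A = sep r' S A.
Proof.
move=> h; rewrite /sep; case: (boolP (A \subset S)) => //= sA.
by rewrite !h ?inE ?subsetDl.
Qed.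

Lemma eq_sconn r r' S : {in [pred X : {set T} | X \subset S], r =1 r'} ->
  sconn r S = sconn r' S.
Proof. by move=> h; apply: eq_forallb => A; rewrite (eq_sep _ h). Qed.

(* A separation of the deletion and one of the contraction uncross, by
   submodularity, into a separation of [S]. *)
Lemma sconn_delete_or_contract r S e : rank_axioms r -> sconn r S -> e \in S ->
  sconn r (S :\ e) || sconn (contract r e) (S :\ e).
Proof.
move=> rax /sconnP cS eS; apply/negPn/negP; rewrite negb_or => /andP[].
case/sconnPn=> A [hA A0 B0]; case/sconnPn=> C [hC C0 D0].
set B := (S :\ e) :\: A in B0; set D := (S :\ e) :\: C in D0.
have sA := sep_sub hA; have sC := sep_sub hC.
have rA := sepE hA; have rC := sepE hC; rewrite -/B in rA; rewrite -/D in rC.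
have cc := contractE rax e.
have sSe : (S :\ e) :|: [set e] = S by rewrite setUC setD1K.
have rC' : r (C :|: [set e]) + r (D :|: [set e]) = r S + r [set e].
  by move: (cc C) (cc D) (cc (S :\ e)) rC; rewrite sSe; clear; lia.
have re := rk1_le rax e.
have rS : r (S :\ e) <= r S by apply: rk_mono => //; apply: subsetDl.
(* Nonempty intersections do not separate [S], so the four ranks would add up to at least
   [2 * r S + 2], whereas the two submodular inequalities bound them by [2 * r S + r [set e]]. *)
have key A' B' C' D' : A' :|: B' = S :\ e -> [disjoint A' & B'] ->
    C' :|: D' = S :\ e -> [disjoint C' & D'] ->
    r A' + r B' = r (S :\ e) ->
    r (C' :|: [set e]) + r (D' :|: [set e]) = r S + r [set e] ->
    A' :&: C' = set0 \/ B' :&: D' = set0.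
  move=> eAB dAB eCD dCD rAB rCD.
  have [->|nAC] := eqVneq (A' :&: C') set0; first by left.
  have [->|nBD] := eqVneq (B' :&: D') set0; first by right.
  exfalso.
  have h1 := rk_submod rax A' (C' :|: [set e]).
  have h2 := rk_submod rax B' (D' :|: [set e]).
  have mem x : [/\ (x \in A') || (x \in B') = (x != e) && (x \in S),
      (x \in C') || (x \in D') = (x != e) && (x \in S),
      ~~ ((x \in A') && (x \in B')) & ~~ ((x \in C') && (x \in D'))].
    have : (x \in A' :|: B') = (x \in S :\ e) by rewrite eAB.
    have : (x \in C' :|: D') = (x \in S :\ e) by rewrite eCD.
    rewrite !inE => -> ->; split => //.
      by apply/negP => /andP[xA xB]; rewrite (disjointFr dAB xA) in xB.
    by apply/negP => /andP[xA xB]; rewrite (disjointFr dCD xA) in xB.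
  have i1 : A' :&: (C' :|: [set e]) = A' :&: C'.
    apply/setP => x; rewrite !inE; have [] := mem x; case: eqVneq => [->|_] /=;
    by rewrite ?eS; case: (_ \in A'); case: (_ \in B'); case: (_ \in C');
      case: (_ \in D'); case: (_ \in S).
  have i2 : B' :&: (D' :|: [set e]) = B' :&: D'.
    apply/setP => x; rewrite !inE; have [] := mem x; case: eqVneq => [->|_] /=;
    by rewrite ?eS; case: (_ \in A'); case: (_ \in B'); case: (_ \in C');
      case: (_ \in D'); case: (_ \in S).
  have i3 : A' :|: (C' :|: [set e]) = S :\: (B' :&: D').
    apply/setP => x; rewrite !inE; have [] := mem x; case: eqVneq => [->|_] /=;
    by rewrite ?eS; case: (_ \in A'); case: (_ \in B'); case: (_ \in C');
      case: (_ \in D'); case: (_ \in S).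
  have i4 : B' :|: (D' :|: [set e]) = S :\: (A' :&: C').
    apply/setP => x; rewrite !inE; have [] := mem x; case: eqVneq => [->|_] /=;
    by rewrite ?eS; case: (_ \in A'); case: (_ \in B'); case: (_ \in C');
      case: (_ \in D'); case: (_ \in S).
  rewrite i1 i3 in h1; rewrite i2 i4 in h2.
  have eN (X : {set T}) : X \subset S :\ e -> X != set0 -> r S < r X + r (S :\: X).
    move=> sX X0; rewrite ltnNge; apply/negP => le.
    have sXS : X \subset S by apply: subset_trans sX (subsetDl _ _).
    have [x0|xS] := cS X (sep_le rax sXS le); first by rewrite x0 eqxx in X0.
    by move/subsetP: sX => /(_ e); rewrite xS !inE eqxx eS => /(_ isT).
  have g1 : A' :&: C' \subset S :\ e.
    by rewrite -eAB; apply: subset_trans (subsetIl _ _) (subsetUl _ _).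
  have g2 : B' :&: D' \subset S :\ e.
    by rewrite -eAB; apply: subset_trans (subsetIl _ _) (subsetUr _ _).
  by move: (eN _ g1 nAC) (eN _ g2 nBD) h1 h2 rAB rCD re rS; clear; lia.
have uAB : A :|: B = S :\ e by rewrite /B; sets.
have uCD : C :|: D = S :\ e by rewrite /D; sets.
have dj (X Y Z : {set T}) : X :&: (Y :\: X) = set0 by sets.
have dAB : [disjoint A & B] by rewrite -setI_eq0 /B dj.
have dCD : [disjoint C & D] by rewrite -setI_eq0 /D dj.
have dDC : [disjoint D & C] by rewrite disjoint_sym.
have uDC : D :|: C = S :\ e by rewrite setUC.
have k1 := key A B C D uAB dAB uCD dCD rA rC'.
have rC2 := rC'; rewrite addnC in rC2.
have k2 := key A B D C uAB dAB uDC dDC rA rC2.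
have split2 (X Y Z : {set T}) : X \subset Y :|: Z -> X :&: Y = set0 ->
    X :&: Z = set0 -> X = set0.
  by move=> s e1 e2; rewrite -(setIidPl s) setIUr e1 e2 setU0.
(* In each case one of [A], [B], [C], [D] misses both sides of the other partition, hence is
   empty. *)
case: k1 => k1; case: k2 => k2.
- by move: A0; rewrite (split2 A C D) ?eqxx // uCD.
- by move: C0; rewrite (split2 C A B) ?eqxx // 1?setIC // uAB.
- by move: D0; rewrite (split2 D A B) ?eqxx // 1?setIC // uAB -uCD subsetUr.
- by move: B0; rewrite (split2 B C D) ?eqxx // uCD -uAB subsetUr.
Qed.

(** The question is whether [K] is already dependent under [r]. If not, its dependence in the
    contraction comes from [e], which then is not a loop. *)
Lemma circuit_contract_lift r e K : rank_axioms r -> e \notin K ->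
  is_circuit (contract r e) K -> is_circuit r K \/ is_circuit r (e |: K).
Proof.
move=> rax eK /andP[dK /forallP iK].
have re := rk1_le rax e; have cc := contractE rax e.
have ind z : z \in K -> r ((K :\ z) :|: [set e]) = #|K :\ z| + r [set e].
  move=> zK; rewrite -cc; congr (_ + _); apply/eqP.
  by move: (iK z); rewrite zK.
have [lt|ge] := ltnP (r K) #|K|.
  left; rewrite /is_circuit lt /=; apply/forallP => z; apply/implyP => zK.
  by have := ind z zK; have := rkU_le rax (K :\ z) [set e];
     have := rk_le_card rax (K :\ z); lia.
have rK : r K = #|K| by have := rk_le_card rax K; lia.
have rKe := cc K; rewrite setUC in rKe.
have re1 : r [set e] = 1.
  have : r K <= r (e |: K) by apply/rk_mono => //; apply: subsetUr.
  by lia.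
right; rewrite /is_circuit cardsU1 eK add1n; apply/andP; split; first by lia.
apply/forallP => z; apply/implyP; rewrite in_setU1 => /orP[/eqP->|zK].
  by rewrite setU1K // rK.
have ze : z != e by apply: contraNneq eK => <-.
have -> : (e |: K) :\ z = (K :\ z) :|: [set e].
  by apply/setP => x; rewrite !inE; case: (eqVneq x e) => [->|]; rewrite ?orbF ?orbT //= eq_sym ze.
by rewrite ind // re1 setUC cardsU1 !inE (negPf eK) andbF add1n addn1.
Qed.

(** A third element can be deleted or contracted without losing connectedness, and a circuit through
    [x] and [y] in the smaller matroid lifts back. The induction ends at [S = [set x; y]], which is
    itself a circuit. *)
Lemma sconn_linked n r S : rank_axioms r -> #|S| <= n -> sconn r S ->
  circ_linked r S S.
Proof.
elim: n => [|n IH] in r S *.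
  by move=> _; rewrite leqn0 cards_eq0 => /eqP-> _ x y; rewrite inE.
move=> rax cS hS x y xS yS xy.
have [/existsP[e /and3P[eS ex ey]]|] := boolP [exists e, [&& e \in S, e != x & e != y]].
  have cS' : #|S :\ e| <= n by rewrite (cardsD1 e) eS in cS.
  have xS' : x \in S :\ e by rewrite !inE eq_sym ex.
  have yS' : y \in S :\ e by rewrite !inE eq_sym ey.
  case/orP: (sconn_delete_or_contract rax hS eS) => h.
    have [K [sK cK xK yK]] := IH _ _ rax cS' h _ _ xS' yS' xy.
    by exists K; split=> //; apply: subset_trans sK (subsetDl _ _).
  have [K [sK cK xK yK]] := IH _ _ (contract_rank_axioms rax e) cS' h _ _ xS' yS' xy.
  have eK : e \notin K.
    by apply/negP => /(subsetP sK); rewrite !inE eqxx.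
  have sKS : K \subset S by apply: subset_trans sK (subsetDl _ _).
  case: (circuit_contract_lift rax eK cK) => cK'; first by exists K.
  by exists (e |: K); split=> //; rewrite ?inE ?xK ?yK ?orbT // subUset sub1set eS.
rewrite negb_exists => /forallP h.
have eS : S = [set x; y].
  apply/setP => z; rewrite !inE.
  have [->|zx] := eqVneq z x; first by rewrite xS.
  have [->|zy] := eqVneq z y; first by rewrite yS.
  by have := h z; rewrite zx zy !andbT => /negPf.
exists S; split=> //.
have rx := rk1_le rax x; have ry := rk1_le rax y.
have eSx : S :\ x = [set y].
  by rewrite eS; apply/setP => z; rewrite !inE; case: (eqVneq z x) => [->|] //=; rewrite (negPf xy).
have eSy : S :\ y = [set x].
  rewrite eS; apply/setP => z; rewrite !inE; case: (eqVneq z y) => [->|] //=; rewrite ?orbF //.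
  by rewrite eq_sym (negPf xy).
have mx : r [set x] <= r S by apply: rk_mono => //; rewrite sub1set.
have my : r [set y] <= r S by apply: rk_mono => //; rewrite sub1set.
have lt : r S < r [set x] + r [set y].
  rewrite ltnNge; apply/negP => le; move/sconnP: hS => /(_ [set x]).
  rewrite sep_le ?sub1set ?eSx // => /(_ isT)[/setP/(_ x)|/setP/(_ y)].
    by rewrite !inE eqxx.
  by rewrite yS !inE eq_sym (negPf xy).
rewrite /is_circuit {2}eS cards2 xy; apply/andP; split; first by lia.
apply/forallP => z; apply/implyP; rewrite {1}eS !inE => /orP[]/eqP->.
  by rewrite eSx cards1; lia.
by rewrite eSy cards1; lia.
Qed.

Lemma connected_sconn r S : rank_axioms r -> connected_m r S <-> sconn r S.
Proof.
move=> rax; split=> [h|]; last exact: sconn_linked (leqnn _).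
apply/negPn/negP => /sconnPn[A [hA /set0Pn[x xA] /set0Pn[y]]].
rewrite inE => /andP[yA yS].
have xS := subsetP (sep_sub hA) x xA.
have xy : x != y by apply: contraNneq yA => <-.
have [K [sK cK xK yK]] := h x y xS yS xy.
have KA : K :&: A != set0 by apply/set0Pn; exists x; rewrite inE xK.
by move/subsetP: (circuit_sep rax cK sK hA KA) => /(_ y yK); apply/negP.
Qed.

(** The hypothesis excludes the empty ground set, whose only component in the sense of [component]
    is empty. *)
Lemma componentP r S C : rank_axioms r -> S != set0 ->
  component r S C <-> [/\ C != set0, sep r S C & sconn r C].
Proof.
move=> rax S0; split.
  case=> sC lC mC; have C0 : C != set0.
    apply/negP => /eqP C0; case/set0Pn: S0 => x xS.
    apply: (mC [set x]); first by rewrite C0 properE sub0set subset0 -cards_eq0 cards1.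
      by rewrite sub1set.
    by move=> u v; rewrite !inE => /eqP-> /eqP->; rewrite eqxx.
  case/set0Pn: (C0) => x xC; have xS := subsetP sC x xC.
  have [hD xD _] := cmpP rax xS; have cD := cmp_sconn rax xS.
  suff -> : C = cmp r S x by split=> //; apply/set0Pn; exists x.
  have sCD : C \subset cmp r S x.
    apply/subsetP => y yC; have [<-//|xy] := eqVneq x y.
    have [K [sK cK xK yK]] := lC x y xC yC xy.
    have KA : K :&: cmp r S x != set0 by apply/set0Pn; exists x; rewrite inE xK.
    exact: (subsetP (circuit_sep rax cK sK hD KA)).
  apply/eqP; rewrite eqEproper sCD; apply/negP => pr.
  apply: (mC _ pr (sep_sub hD)) => u v uD vD uv.
  have [K [sK cK uK vK]] := sconn_linked rax (leqnn _) cD uD vD uv.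
  by exists K; split=> //; apply: subset_trans sK (sep_sub hD).
case=> C0 hC cC; split; first exact: sep_sub hC.
  move=> u v uC vC uv.
  have [K [sK cK uK vK]] := sconn_linked rax (leqnn _) cC uC vC uv.
  by exists K; split=> //; apply: subset_trans sK (sep_sub hC).
move=> D /properP[sCD [y yD yC]] sD lD; case/set0Pn: C0 => x xC.
have xD := subsetP sCD x xC.
have xy : x != y by apply: contraNneq yC => <-.
have [K [sK cK xK yK]] := lD x y xD yD xy.
have KA : K :&: C != set0 by apply/set0Pn; exists x; rewrite inE xK.
by move/subsetP: (circuit_sep rax cK sK hC KA) => /(_ y yK); apply/negP.
Qed.

End Connectivity.

(** * Layouts and contraction-deletion-depth *)

(* [a i x] names the level-[i] vertex above [x] in a rooted tree with all leaves
   at depth [D]; the last clause bounds the connectivity of every union of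
   subtrees hanging from one vertex. *)
Definition layout (T : finType) (r : {set T} -> nat) (S : {set T}) (D w : nat) : Prop :=
  exists a : nat -> T -> nat,
    [/\ {in S &, forall x y, a 0 x = a 0 y},
        forall i, {in S &, forall x y, a i.+1 x = a i.+1 y -> a i x = a i y},
        {in S &, forall x y, a D x = a D y -> x = y}
      & forall i (Z : {set T}), i < D -> Z \subset S ->
          {in Z &, forall x y, a i x = a i y} ->
          {in Z & S, forall y z, a i.+1 y = a i.+1 z -> z \in Z} ->
          lambda r Z (S :\: Z) <= w].

Section Cdd.
Variable T : finType.
Implicit Types (r : {set T} -> nat) (S A C K X Y Z : {set T}).

(** The recursive occurrences in [cdd_conn] sit below a disjunction, so an explicit fixpoint carries
    the induction hypothesis into both alternatives. *)
Lemma cdd_le_strong_ind (P : ({set T} -> nat) -> {set T} -> nat -> Prop) :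
  (forall r S d x, S = [set x] -> 1 <= d -> P r S d) ->
  (forall r S d, ~ connected_m r S -> (forall C, component r S C -> P r C d) ->
     P r S d) ->
  (forall r S d a, S <> [set a] -> connected_m r S -> a \in S ->
     P (contract r a) (S :\ a) d \/ P r (S :\ a) d -> P r S d.+1) ->
  forall r S d, cdd_le r S d -> P r S d.
Proof.
move=> h1 h2 h3; fix IH 4 => r S d [].
- by move=> {}r {}S {}d x e1 e2; apply: h1 e1 e2.
- by move=> {}r {}S {}d e1 e2; apply: h2 e1 _ => C /e2; apply: IH.
- move=> {}r {}S {}d a e1 e2 e3 e4; apply: h3 e1 e2 e3 _.
  by case: e4 => h; [left|right]; apply: IH.
Qed.

Lemma lambda_set0 r Y : rank_axioms r -> lambda r set0 Y = 0.
Proof. by move=> rax; rewrite /lambda rk0 // set0U; lia. Qed.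

Lemma lambda_sep r S Z : sep r S Z -> lambda r Z (S :\: Z) = 0.
Proof.
case/andP=> sZ /eqP h; rewrite /lambda h.
have -> : Z :|: (S :\: Z) = S by sets.
by rewrite subnn.
Qed.

Lemma layout_single r x D w : rank_axioms r -> layout r [set x] D w.
Proof.
move=> rax; exists (fun _ _ => 0); split=> //.
  by move=> u v; rewrite !inE => /eqP-> /eqP->.
move=> i Z _; rewrite subset1 => /orP[]/eqP-> _ _.
  by rewrite lambda_sep // sep_full.
by rewrite lambda_set0.
Qed.

(** The element [a] becomes a new child of the root. Putting it back on either side of a cut raises
    the connectivity by at most one, after a deletion as well as after a contraction. The depth is a
    successor because level 0 cannot tell [a] from the rest. *)
Lemma layout_add r r' S a D w : rank_axioms r ->
  r' = r \/ r' = contract r a ->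
  a \in S -> layout r' (S :\ a) D.+1 w -> layout r S D.+1 w.+1.
Proof.
move=> rax r'E aS [b [b0 bS bD bw]].
(* Label 0 is reserved for [a]; the successor keeps the old labels away from it. *)
pose c i x := if i is j.+1 then if x == a then 0 else (b i x).+1 else 0.
have memS x : x \in S -> x != a -> x \in S :\ a.
  by move=> xS xa; rewrite !inE xa xS.
exists c; split=> //.
- move=> [|i] x y xS yS //; rewrite /c.
  have [xa|xa] := eqVneq x a; have [ya|ya] := eqVneq y a => //.
  by case=> e ; rewrite (bS _ _ _ _ _ e) // memS.
- move=> x y xS yS; rewrite /c.
  have [xa|xa] := eqVneq x a; have [ya|ya] := eqVneq y a => //; first by rewrite xa.
  by case=> e; apply: bD e; apply: memS.
move=> i Z iD sZ hZ sat.
have le1 : lambda r' (Z :\ a) ((S :\ a) :\: (Z :\ a)) <= w.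
  apply: (bw i) => //; first by sets.
    move=> x y; rewrite !inE => /andP[/negPf xa xZ] /andP[/negPf ya yZ].
    have xS := subsetP sZ x xZ; have yS := subsetP sZ y yZ.
    case: i => [|i] in iD hZ sat *; first by apply: b0; rewrite memS ?xa ?ya.
    by have := hZ x y xZ yZ; rewrite /c xa ya; case.
  move=> x y; rewrite !inE => /andP[/negPf xa xZ] /andP[/negPf ya yS] e.
  rewrite ya /=; apply: (sat x y) => //=.
  by rewrite /c xa ya e.
rewrite -ltnS in le1; apply: leq_trans le1.
have re := rk1_le rax a.
have eS : S = a |: (S :\ a) by rewrite setD1K.
have [aZ|aZ] := boolP (a \in Z).
  have eZ : Z = a |: (Z :\ a) by rewrite setD1K.
  have eSZ : S :\: Z = (S :\ a) :\: (Z :\ a).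
    by apply/setP => x; rewrite !inE; case: eqVneq => [->|]; rewrite ?aZ.
  rewrite /lambda.
  have -> : Z :|: (S :\: Z) = S by sets.
  have -> : Z :\ a :|: ((S :\ a) :\: (Z :\ a)) = S :\ a by sets.
  rewrite -eSZ.
  have h1 : r (S :\: Z) <= r (S :\: Z :|: [set a]) by apply: rk_mono => //; apply: subsetUl.
  have h2 : r (S :\ a) <= r S by apply: rk_mono => //; apply: subsetDl.
  have h3 : r Z <= r [set a] + r (Z :\ a) by rewrite {1}eZ; apply: rkU_le.
  have h4 : r [set a] <= r (S :\: Z :|: [set a]) by apply: rk_mono => //; apply: subsetUr.
  have h5 : r [set a] <= r Z by apply: rk_mono => //; rewrite sub1set.
  have h6 : r [set a] <= r S by apply: rk_mono => //; rewrite sub1set.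
  case: r'E => ->; first by move: h1 h2 h3 h4 re; clear; lia.
  rewrite /contract.
  have -> : Z :\ a :|: [set a] = Z by rewrite setUC setD1K.
  have -> : S :\ a :|: [set a] = S by rewrite setUC setD1K.
  by move: h1 h2 h3 h4 h5 h6 re; clear; lia.
have eZ : Z :\ a = Z.
  by apply/setP => x; rewrite !inE; case: eqVneq => [->|]; rewrite ?(negPf aZ).
rewrite eZ /lambda.
have -> : Z :|: (S :\: Z) = S by sets.
have -> : Z :|: ((S :\ a) :\: Z) = S :\ a.
  by apply/setP => x; rewrite !inE; move/subsetP: sZ => /(_ x);
     case: eqVneq => [->|]; rewrite ?(negPf aZ) //= => _; case: (x \in Z) => // ->.
have eSZ : (S :\: Z) = a |: ((S :\ a) :\: Z).
  by apply/setP => x; rewrite !inE; case: eqVneq => [->|]; rewrite ?(negPf aZ) ?aS.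
have h1 : r Z <= r (Z :|: [set a]) by apply: rk_mono => //; apply: subsetUl.
have h2 : r (S :\ a) <= r S by apply: rk_mono => //; apply: subsetDl.
have h3 : r (S :\: Z) <= r [set a] + r ((S :\ a) :\: Z) by rewrite {1}eSZ; apply: rkU_le.
have h4 : r [set a] <= r (Z :|: [set a]) by apply: rk_mono => //; apply: subsetUr.
have h5 : r [set a] <= r (S :\: Z) by apply: rk_mono => //; rewrite sub1set inE aS aZ.
have h6 : r [set a] <= r S by apply: rk_mono => //; rewrite sub1set.
case: r'E => ->; first by move: h1 h2 h3 h4 re; clear; lia.
rewrite /contract.
have -> : (S :\ a) :\: Z :|: [set a] = S :\: Z by rewrite setUC eSZ.
have -> : S :\ a :|: [set a] = S by rewrite setUC setD1K.
by move: h1 h2 h3 h4 h5 h6 re; clear; lia.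
Qed.

Lemma cmp_eq r S x y : rank_axioms r -> x \in S -> y \in cmp r S x ->
  cmp r S y = cmp r S x.
Proof.
move=> rax xS yC; have [hC _ _] := cmpP rax xS.
by apply/esym/sconn_sep_cmp => //; apply: cmp_sconn.
Qed.

(** A new root gets one child per component. A union of components has connectivity 0, and a set
    inside a component [C] has no larger connectivity in [S] than in [C], because [S] is the direct
    sum of [C] and the rest. *)
Lemma layout_components r S D w : rank_axioms r ->
  (forall C, C != set0 -> sep r S C -> sconn r C -> layout r C D w) ->
  layout r S D.+1 w.
Proof.
move=> rax H.
(* The guard lets labels be chosen for all sets at once; they are arbitrary on sets that are not
   components. *)
pose Q C (a : nat -> T -> nat) :=
  [&& C != set0, sep r S C & sconn r C] ->
    [/\ {in C &, forall x y, a 0 x = a 0 y},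
        forall i, {in C &, forall x y, a i.+1 x = a i.+1 y -> a i x = a i y},
        {in C &, forall x y, a D x = a D y -> x = y}
      & forall i (Z : {set T}), i < D -> Z \subset C ->
          {in Z &, forall x y, a i x = a i y} ->
          {in Z & C, forall y z, a i.+1 y = a i.+1 z -> z \in Z} ->
          lambda r Z (C :\: Z) <= w].
have [C|b hb] := @fin_all_exists {set T} (fun=> nat -> T -> nat) Q.
  have [/and3P[h1 h2 h3]|h] := boolP [&& C != set0, sep r S C & sconn r C].
    by have [a ha] := H C h1 h2 h3; exists a => _.
  by exists (fun _ _ => 0); rewrite /Q (negPf h).
have cmpS x : x \in S -> [&& cmp r S x != set0, sep r S (cmp r S x) & sconn r (cmp r S x)].
  move=> xS; have [h1 h2 _] := cmpP rax xS; rewrite h1 cmp_sconn // andbT.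
  by rewrite andbT; apply/set0Pn; exists x.
have cmpx x : x \in S -> x \in cmp r S x by move=> /(cmpP rax)[].
pose c i x := if i is j.+1 then pickle (cmp r S x, b (cmp r S x) j x) else 0.
have cE i x y : c i.+1 x = c i.+1 y <->
    cmp r S x = cmp r S y /\ b (cmp r S x) i x = b (cmp r S y) i y.
  split=> [/(pcan_inj pickleK) [-> ->] //|[e1 e2]].
  by rewrite /c e2 e1.
exists c; split=> //.
- move=> [|i] x y xS yS // /cE[e1 e2]; apply/cE; split=> //.
  have [_ h _ _] := hb _ (cmpS x xS); rewrite -e1 in e2 *; apply: h => //.
    exact: cmpx.
  by rewrite e1 cmpx.
- move=> x y xS yS /cE[e1 e2].
  have [_ _ h _] := hb _ (cmpS x xS); rewrite -e1 in e2; apply: h => //.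
    exact: cmpx.
  by rewrite e1 cmpx.
move=> [|i] Z iD sZ hZ sat.
  have <- : \bigcup_(x in Z) cmp r S x = Z.
    apply/setP => y; apply/bigcupP/idP => [[x xZ yC]|yZ].
      have xS := subsetP sZ x xZ.
      have [hC _ _] := cmpP rax xS; have yS := subsetP (sep_sub hC) y yC.
      apply: (sat x y) => //; apply/cE; rewrite (cmp_eq rax xS yC); split=> //.
      by have [h _ _ _] := hb _ (cmpS x xS); apply: h => //; apply: cmpx.
    by exists y => //; apply: cmpx; apply: (subsetP sZ).
  rewrite lambda_sep //.
  apply: (big_ind (fun A => sep r S A)).
  - by rewrite -(setDv S); apply/sepC/sep_full.
  - exact: sepU.
  - by move=> x xZ; have [] := cmpP rax (subsetP sZ x xZ).
have [->|[x xZ]] := set_0Vmem Z; first by rewrite lambda_set0.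
have xS := subsetP sZ x xZ; have /and3P[_ hC _] := cmpS x xS.
set C := cmp r S x in hC.
have eC y : y \in Z -> cmp r S y = C by move=> yZ; have [] := (cE _ _ _).1 (hZ y x yZ xZ).
have sZC : Z \subset C.
  by apply/subsetP => y yZ; rewrite -(eC y yZ); apply: cmpx; apply: (subsetP sZ).
apply: leq_trans (_ : lambda r Z (C :\: Z) <= w).
  have sC := sep_sub hC; have := sepE hC.
  rewrite /lambda.
  have -> : Z :|: (S :\: Z) = S by sets.
  have -> : Z :|: (C :\: Z) = C by sets.
  have := rkD_le rax (S :\: Z) (C :\: Z).
  have -> : (S :\: Z) :\: (C :\: Z) = S :\: C by sets.
  by clear; lia.
have [_ _ _ h] := hb _ (cmpS x xS); apply: (h i) => //.
  move=> y z yZ zZ; have := hZ y z yZ zZ; case/cE => _.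
  by rewrite !eC.
move=> y z yZ zC e; have zS := subsetP (sep_sub hC) z zC.
apply: (sat y z) => //; apply/cE; rewrite eC // /C (cmp_eq rax xS zC); split=> //.
Qed.

(** Splitting into components costs a level of the layout but no unit of [d]. Components are
    connected, so two such splits never follow each other; the sharper bound for connected [S]
    records this. *)
Lemma cdd_layout r S d : rank_axioms r -> cdd_le r S d ->
  layout r S d.+1 d /\ (connected_m r S -> layout r S d d).
Proof.
move=> + h; move: r S d h; apply: cdd_le_strong_ind.
- by move=> r S d x -> _ rax; split=> [|_]; apply: layout_single.
- move=> r S d nc IH rax; split=> //; apply: layout_components => // C C0 hC cC.
  have S0 : S != set0.
    by apply: contraNneq C0 => S0; have := sep_sub hC; rewrite S0 subset0.
  have /IH/(_ rax)[_] : component r S C by apply/componentP.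
  by apply; apply/connected_sconn.
- move=> r S d a nS cS aS H rax.
  have L : layout r S d.+1 d.+1.
    case: H => H.
      have [h _] := H (contract_rank_axioms rax a).
      by apply: (@layout_add _ (contract r a) _ a) => //; right.
    have [h _] := H rax.
    by apply: (@layout_add _ r _ a) => //; left.
  split=> //; apply: layout_components => // C C0 hC cC.
  have /sconnP h := (connected_sconn S rax).1 cS.
  by case: (h C hC) => [e|->] //; rewrite e eqxx in C0.
Qed.

(** * Upper bounds on contraction-deletion-depth *)

Lemma eq_circuit r r' K : {in [pred X : {set T} | X \subset K], r =1 r'} ->
  is_circuit r K = is_circuit r' K.
Proof.
move=> h; rewrite /is_circuit h ?inE //; congr (_ && _).
by apply: eq_forallb => x; rewrite h // inE subsetDl.
Qed.

Lemma eq_circ_linked r r' S X : {in [pred X : {set T} | X \subset S], r =1 r'} ->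
  circ_linked r S X -> circ_linked r' S X.
Proof.
move=> h H x y xX yX xy; have [K [sK cK xK yK]] := H x y xX yX xy.
exists K; split=> //; rewrite -(@eq_circuit r) // => Z sZ; apply: h.
exact: subset_trans sZ sK.
Qed.

Lemma eq_component r r' S C : {in [pred X : {set T} | X \subset S], r =1 r'} ->
  component r S C -> component r' S C.
Proof.
move=> h [sC lC mC]; split=> //; first exact: eq_circ_linked lC.
move=> D pD sD lD; apply: (mC D) => //; apply: eq_circ_linked lD.
by move=> X /h.
Qed.

(** [cdd_le] is indexed by a function on all sets, while the rank functions to be compared agree
    only on subsets of the ground set. *)
Lemma eq_cdd r r' S d : {in [pred X : {set T} | X \subset S], r =1 r'} ->
  cdd_le r S d -> cdd_le r' S d.
Proof.
move=> + h; move: r S d h r'; apply: cdd_le_strong_ind.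
- by move=> r S d x -> d1 r' _; apply: cdd_single.
- move=> r S d nc IH r' h; apply: cdd_disconn.
    by move=> c; apply: nc; apply: eq_circ_linked c => X /h.
  move=> C hC; have sC : C \subset S by case: hC.
  apply: IH; first by apply: eq_component hC => X /h.
  by move=> X sX; apply: h; apply: subset_trans sX sC.
- move=> r S d a nS cS aS H r' h; apply: (cdd_conn nS _ aS).
    exact: eq_circ_linked cS.
  case: H => H; [left|right]; apply: H => X sX.
    have sXa : X :|: [set a] \subset S.
      by rewrite subUset sub1set aS (subset_trans sX (subsetDl _ _)).
    by rewrite /contract (h _ sXa) h // inE sub1set.
  by apply: h; apply: subset_trans sX (subsetDl _ _).
Qed.

Lemma cdd_leS r S d : cdd_le r S d -> cdd_le r S d.+1.
Proof.
move: r S d; apply: cdd_le_strong_ind.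
- by move=> r S d x -> d1; apply: cdd_single (erefl _) _.
- by move=> r S d nc IH; apply: cdd_disconn.
- by move=> r S d a nS cS aS H; apply: cdd_conn nS cS aS H.
Qed.

(** Bounding the components is stable under direct sums. It also holds vacuously for the empty
    ground set, where [cdd_le] never holds, so removing the last element is no exception. *)
Definition cdd_comps r S c :=
  forall C, C != set0 -> sep r S C -> sconn r C -> cdd_le r C c.

Lemma cdd_comps_cdd r S c : rank_axioms r -> S != set0 ->
  cdd_comps r S c -> cdd_le r S c.
Proof.
move=> rax S0 H; have [cS|nS] := boolP (sconn r S).
  by apply: H => //; apply: sep_full.
apply: cdd_disconn; first by move/(connected_sconn _ rax); apply/negP.
by move=> C /(componentP _ rax S0)[]; apply: H.
Qed.

Lemma cdd_comps_sep r S A c : rank_axioms r -> sep r S A ->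
  cdd_comps r S c -> cdd_comps r A c.
Proof. by move=> rax hA H C C0 hC; apply: H => //; apply: sep_trans hA hC. Qed.

Lemma eq_cdd_comps r r' S c : {in [pred X : {set T} | X \subset S], r =1 r'} ->
  cdd_comps r S c -> cdd_comps r' S c.
Proof.
move=> h H C C0 hC cC; have sC := sep_sub hC.
have hsub : {in [pred X : {set T} | X \subset C], r =1 r'}.
  by move=> X sX; apply: h; apply: subset_trans sX sC.
apply: (eq_cdd hsub); apply: H => //; first by rewrite (eq_sep _ h).
by rewrite (eq_sconn hsub).
Qed.

Lemma cdd_comps_union r S1 S2 c : rank_axioms r -> sep r (S1 :|: S2) S1 ->
  cdd_comps r S1 c -> cdd_comps r S2 c -> cdd_comps r (S1 :|: S2) c.
Proof.
move=> rax h1 H1 H2 C C0 hC cC.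
have sC := sep_sub hC; have := sep_restr rax h1 sC.
move/sconnP: (cC) => /[apply] [[e|e]].
  apply: H2 => //.
  have s2 : C \subset S2.
    apply/subsetP => x xC; move/subsetP: sC => /(_ x xC); rewrite inE => /orP[x1|//].
    by have := in_set0 x; rewrite -e inE xC x1.
  by have := sep_restr rax hC (subsetUr S1 S2); rewrite (setIidPr s2).
apply: H1 => //.
have s2 : C \subset S1 by rewrite -e subsetIr.
by have := sep_restr rax hC (subsetUl S1 S2); rewrite (setIidPr s2).
Qed.

Lemma contract_sep r S C a : rank_axioms r -> sep r S C -> a \in S -> a \notin C ->
  {in [pred X : {set T} | X \subset C], r =1 contract r a}.
Proof.
move=> rax hC aS aC X sX; rewrite inE in sX.
have s : X :|: [set a] \subset S.
  by rewrite subUset sub1set aS (subset_trans sX (sep_sub hC)).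
have := sepE (sep_restr rax hC s); have := contractE rax a X.
have aX : a \notin X by apply: contra aC; apply: (subsetP sX).
have -> : (X :|: [set a]) :&: C = X by sets.
have -> : (X :|: [set a]) :\: X = [set a] by sets.
by lia.
Qed.

(** Only the component containing [a] is affected. On any other, contracting [a] does not change the
    rank function, by [contract_sep]. *)
Lemma cdd_comps_contract r S a c : rank_axioms r -> a \in S ->
  cdd_comps (contract r a) (S :\ a) c -> cdd_comps r S c.+1.
Proof.
move=> rax aS H C C0 hC cC; have sC := sep_sub hC; have eC := sepE hC.
have cax := contract_rank_axioms rax a.
have eSa : S :\ a :|: [set a] = S by rewrite setUC setD1K.
have ceS := contractE rax a (S :\ a); rewrite eSa in ceS.
have [aC|aC] := boolP (a \in C).
  (* [cdd_conn] excludes the singleton, and nothing would be left of it after removing [a]. *)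
  have [->|/eqP nC] := eqVneq C [set a]; first exact: cdd_single (erefl _) _.
  apply: (cdd_conn nC _ aC); first exact/connected_sconn.
  left; apply: cdd_comps_cdd => //.
    apply/set0Pn; move/eqP: nC => nC.
    have /subsetPn[x xC] : ~~ (C \subset [set a]).
      by rewrite subset1 negb_or nC C0.
    by rewrite inE => xa; exists x; rewrite !inE xa.
  apply: cdd_comps_sep H => //; apply: sep_le => //; first exact: setSD.
  have h1 := contractE rax a (C :\ a).
  have h2 := contractE rax a ((S :\ a) :\: (C :\ a)).
  have e1 : C :\ a :|: [set a] = C by rewrite setUC setD1K.
  have e2 : (S :\ a) :\: (C :\ a) :|: [set a] = (S :\: C) :|: [set a].
    by apply/setP => x; rewrite !inE; case: eqVneq => [->|]; rewrite ?orbT.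
  rewrite e1 in h1; rewrite e2 in h2.
  have := rkU_le rax (S :\: C) [set a].
  by move: h1 h2 eC ceS; clear; lia.
have ext := contract_sep rax hC aS aC.
apply: cdd_leS; apply: eq_cdd (_ : cdd_le (contract r a) C c).
  by move=> X /ext.
have sCa : C \subset S :\ a.
  by apply/subsetP => x xC; rewrite !inE (subsetP sC) // andbT; apply: contraNneq aC => <-.
apply: H => //; last by rewrite -(eq_sconn ext).
apply: sep_le => //; rewrite -ext ?inE //.
have := contractE rax a ((S :\ a) :\: C).
have -> : (S :\ a) :\: C :|: [set a] = S :\: C.
  by apply/setP => x; rewrite !inE; case: eqVneq => [->|]; rewrite ?orbT ?aC ?aS ?orbF.
by move: eC ceS; clear; lia.
Qed.

Lemma cdd_comps_delete r S a c : rank_axioms r -> a \in S ->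
  cdd_comps r (S :\ a) c -> cdd_comps r S c.+1.
Proof.
move=> rax aS H C C0 hC cC; have sC := sep_sub hC.
have hCa := sep_restr rax hC (subsetDl S [set a]).
have [aC|aC] := boolP (a \in C).
  have [->|/eqP nC] := eqVneq C [set a]; first exact: cdd_single (erefl _) _.
  apply: (cdd_conn nC _ aC); first exact/connected_sconn.
  right; apply: cdd_comps_cdd => //.
    apply/set0Pn; move/eqP: nC => nC.
    have /subsetPn[x xC] : ~~ (C \subset [set a]).
      by rewrite subset1 negb_or nC C0.
    by rewrite inE => xa; exists x; rewrite !inE xa.
  apply: cdd_comps_sep H => //.
  suff <- : (S :\ a) :&: C = C :\ a by [].
  by rewrite setIDAC (setIidPr sC).
apply/cdd_leS/H => //; suff <- : (S :\ a) :&: C = C by [].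
rewrite setIDAC (setIidPr sC).
by apply/setP => x; rewrite !inE; case: eqVneq => [->|]; rewrite ?(negPf aC).
Qed.

End Cdd.

(** Labels are pulled back along [f]. The image of [Z] is enlarged to the union [Z'] of the
    next-level classes that it meets, and the contracted set is split as [C1] and [C2] between [Z']
    and its complement. Submodularity then shows that contracting does not raise the
    connectivity. *)
Lemma layout_minor (M N : matroid) D w : is_minor M N ->
  layout (rk N) [set: elt N] D w -> layout (rk M) [set: elt M] D w.
Proof.
case=> f [C [injf dC rkE]] [a [a0 aS aD aw]].
have nax := rk_ax N; have max := rk_ax M.
exists (fun i x => a i (f x)); split.
- by move=> x y _ _; apply: a0; rewrite inE.
- by move=> i x y _ _; apply: aS; rewrite inE.
- by move=> x y _ _ e; apply/injf/(aD _ _ (in_setT _) (in_setT _) e).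
move=> i Z iD _ hZ sat.
pose Z' := [set y | [exists x in Z, a i.+1 (f x) == a i.+1 y]].
have Z'P y : reflect (exists2 x, x \in Z & a i.+1 (f x) = a i.+1 y) (y \in Z').
  rewrite inE; apply: (iffP existsP) => [[x /andP[xZ /eqP e]]|[x xZ e]]; exists x => //.
  by rewrite xZ e eqxx.
have le : lambda (rk N) Z' ([set: elt N] :\: Z') <= w.
  apply: (aw i) => //.
    move=> y y' /Z'P[x xZ e] /Z'P[x' xZ' e'].
    rewrite -(aS i _ _ _ _ e) ?inE // -(aS i _ _ _ _ e') ?inE //.
    exact: hZ.
  by move=> y z /Z'P[x xZ e] _ e'; apply/Z'P; exists x => //; rewrite e.
apply: leq_trans le; rewrite !setTD.
have fZ : f @: Z \subset Z'.
  by apply/subsetP => _ /imsetP[x xZ ->]; apply/Z'P; exists x.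
have fZc : f @: (~: Z) \subset ~: Z'.
  apply/subsetP => _ /imsetP[x xZ ->]; move: xZ; rewrite !inE; apply: contra.
  by move=> /existsP[y /andP[yZ /eqP e]]; apply: (sat y x).
set X := f @: Z in fZ; set Y := f @: (~: Z) in fZc.
set r := rk N in nax *.
have -> : lambda (rk M) Z (~: Z) =
    (r (X :|: C) - r C) + (r (Y :|: C) - r C) - (r (X :|: Y :|: C) - r C).
  by rewrite /lambda !rkE -imsetU setUCr.
clearbody X Y Z'; clear Z'P sat hZ dC; pose C1 := C :&: Z'; pose C2 := C :\: Z'.
have h1 := rk_submod nax (X :|: C1) C; have h2 := rk_submod nax (Y :|: C2) C.
have h3 : r C1 <= r ((X :|: C1) :&: C).
  by apply: rk_mono => //; rewrite /C1; sets.
have h4 : r C2 <= r ((Y :|: C2) :&: C).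
  by apply: rk_mono => //; rewrite /C2; sets.
have e1 : (X :|: C1) :|: C = X :|: C by rewrite /C1; sets.
have e2 : (Y :|: C2) :|: C = Y :|: C by rewrite /C2; sets.
rewrite e1 in h1; rewrite e2 in h2.
have h5 : r C <= r C1 + r C2.
  by apply: leq_trans (rkU_le nax _ _); apply: rk_mono => //; rewrite /C1 /C2; sets.
have s1 : X :|: C1 \subset Z' by rewrite /C1; sets.
have s2 : Y :|: C2 \subset ~: Z' by rewrite /C2; sets.
have h6 := lambda_mono nax s1 s2.
have e3 : X :|: C1 :|: (Y :|: C2) = X :|: Y :|: C by rewrite /C1 /C2; sets.
rewrite e3 in h6; rewrite /lambda.
have h7 : r C <= r (X :|: C) by apply: rk_mono => //; apply: subsetUr.
have h8 : r C <= r (Y :|: C) by apply: rk_mono => //; apply: subsetUr.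
have h9 : r C <= r (X :|: Y :|: C) by apply: rk_mono => //; apply: subsetUr.
have h10 := rkU_le nax Z' (~: Z').
by move: h1 h2 h3 h4 h5 h6 h7 h8 h9 h10; clear; lia.
Qed.

(** * Layouts and branch-decompositions *)

Section Graph.
Variables (V : finType) (e : rel V).
Hypothesis tree : is_tree e.
Implicit Types (u v w x y p : V).

Let esym : symmetric e. Proof. by case: tree. Qed.

(** The witness [u] precedes the first visit to [v] on a walk from [w]. *)
Lemma connect_first_hit (R : rel V) w v : connect R w v -> w != v ->
  exists2 u, R u v & connect (delete_vertex R v) w u.
Proof.
case/connectP => q; elim: q w => [|y q IH] w /=; first by move=> _ ->; rewrite eqxx.
case/andP=> Rwy pq lq wv.
have [yv|yv] := eqVneq y v; first by exists w; rewrite -?yv.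
have [u Ru cu] := IH y pq lq yv; exists u => //.
by apply: connect_trans cu; apply: connect1; rewrite /delete_vertex /remove_edge /= Rwy wv yv.
Qed.

Lemma connect_restrict (R : rel V) (P : pred V) y z :
  (forall w, connect R y w -> P w) -> connect R y z ->
  connect [rel a b | R a b && P a && P b] y z.
Proof.
move=> h /connectP[q]; elim: q y h => [|a q IH] y h /=; first by move=> _ ->.
case/andP=> Rya pq lq; apply: connect_trans (IH a _ pq lq).
  by apply: connect1; rewrite /delete_vertex /remove_edge /= Rya !h // connect1.
by move=> w cw; apply: h; apply: connect_trans cw; apply: connect1.
Qed.

Lemma delete_vertex_csym v : connect_sym (delete_vertex e v).
Proof.
apply: sym_connect_sym => x y; rewrite /delete_vertex /= esym.
by rewrite -!andbA; congr (_ && _); rewrite andbC.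
Qed.

Lemma connect_delete_neq v x y : connect (delete_vertex e v) x y -> x != v -> y != v.
Proof.
case/connectP => q; elim: q x => [|a q IH] x /=; first by move=> _ ->.
by case/andP=> /andP[_ av] pq lq _; apply: IH pq lq av.
Qed.

Lemma delete_vertex_neqr v x y : connect (delete_vertex e v) x y -> y != v -> x != v.
Proof. by rewrite delete_vertex_csym; apply: connect_delete_neq. Qed.

(** Otherwise the edge from [v] to [p] and a walk from [p] to [u] avoiding [v] would join the ends
    of the edge between [v] and [u] after its removal. *)
Lemma tree_neighbour_unique v u p : e v u -> e v p ->
  connect (delete_vertex e v) u p -> u = p.
Proof.
move=> evu evp cup; apply/eqP/negPn/negP => up.
case: tree => _ _ irr _ /(_ v u evu)/negP; apply.
have [uv pv] : u != v /\ p != v.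
  by split; apply/eqP => h; [move: evu|move: evp]; rewrite h irr.
apply: (@connect_trans _ _ p).
  apply: connect1; rewrite /delete_vertex /remove_edge /= evp eqxx eq_sym (negPf up) /= eq_sym.
  by rewrite (negPf pv) andbF.
rewrite delete_vertex_csym in cup; apply: connect_sub cup => x y /andP[/andP[exy xv] yv].
by apply: connect1; rewrite /delete_vertex /remove_edge /= exy (negPf xv) (negPf yv) !andbF.
Qed.

Lemma delete_vertex_cover v w : w != v ->
  exists u : nbr e v, connect (delete_vertex e v) (val u) w.
Proof.
move=> wv; have cwv : connect e w v by case: tree.
have [u euv cu] := connect_first_hit cwv wv; rewrite esym in euv.
by exists (Sub u euv); rewrite SubK delete_vertex_csym.
Qed.

Variable c : V.

(* [ball n] is the set of vertices at distance less than [n] from [c]. *)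
Fixpoint ball n : {set V} :=
  if n is m.+1 then c |: [set w | [exists u in ball m, e u w]] else set0.

Lemma ball_step n u w : u \in ball n -> e u w -> w \in ball n.+1.
Proof.
by move=> ub euw; rewrite /= !inE; apply/orP; right; apply/existsP; exists u; rewrite ub.
Qed.

Lemma ball_inv n w : w \in ball n.+1 -> w = c \/ exists2 u, u \in ball n & e u w.
Proof.
rewrite /= !inE => /orP[/eqP|/existsP[u /andP[ub euw]]]; first by left.
by right; exists u.
Qed.

Lemma ballS n w : w \in ball n -> w \in ball n.+1.
Proof.
elim: n w => [|n IH] w; first by rewrite inE.
case/ball_inv => [->|[u /IH ub euw]]; first by rewrite /= !inE eqxx.
exact: ball_step ub euw.
Qed.

Lemma ball_path n u q : u \in ball n -> path e u q -> last u q \in ball (n + size q).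
Proof.
elim: q n u => [|w q IH] n u ub /=; first by rewrite addn0.
by case/andP=> euw pq; rewrite addnS -addSn; apply: IH pq; apply: ball_step ub euw.
Qed.

(** Its components outside the ball are the subtrees whose top vertex is at distance [i] from [c];
    vertices inside the ball are isolated. These components become the classes of level [i]. *)
Definition far i : rel V := [rel x y | e x y && (x \notin ball i) && (y \notin ball i)].

Lemma far_csym i : connect_sym (far i).
Proof.
apply: sym_connect_sym => x y; rewrite /delete_vertex /far /= esym.
by rewrite -!andbA; congr (_ && _); rewrite andbC.
Qed.

Lemma ball_connect n v w : v \notin ball n -> w \in ball n.+1 -> w != v ->
  connect (delete_vertex e v) c w.
Proof.
elim: n w => [|n IH] w vb wb wv.
  by case/ball_inv: wb => [->|[u]]; rewrite ?inE.
case/ball_inv: wb => [->//|[u ub euw]].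
have uv : u != v by apply: contraNneq vb => <-.
have vb' : v \notin ball n by apply: contra vb; apply: ballS.
apply: connect_trans (IH u vb' ub uv) _.
by apply: connect1; rewrite /delete_vertex /remove_edge /far /= euw uv wv.
Qed.

(** Here [v] is the top vertex of its component of [far i]. A branch at [v] reaching [ball i.+1]
    would contain [c], so [v] is not [c] and the branch begins with a neighbour of [v] in [ball i].
    The branch of [y], however, begins outside [ball i]. *)
Lemma branch_far i v y w : v \notin ball i -> v \in ball i.+1 ->
  connect (far i) v y -> y != v -> connect (delete_vertex e v) y w ->
  w \notin ball i.+1.
Proof.
move=> vb vb1 cvy yv cyw; apply/negP => wb.
have wv := connect_delete_neq cyw yv.
have ccw := ball_connect vb wb wv.
case/ball_inv: (vb1) => [vc|[p pb epv]].
  by have := delete_vertex_neqr ccw wv; rewrite vc eqxx.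
case: i => [|i] in vb vb1 cvy wb pb *; first by rewrite inE in pb.
have pv : p != v by apply: contraNneq vb => <-.
have vb' : v \notin ball i by apply: contra vb; apply: ballS.
have ccp := ball_connect vb' pb pv.
rewrite far_csym in cvy.
have [u /andP[/andP[euv ub] _] cyu] := connect_first_hit cvy yv.
have {}cyu : connect (delete_vertex e v) y u.
  apply: connect_sub cyu => a b /andP[/andP[/andP[/andP[eab _] _] av] bv].
  by apply: connect1; rewrite /delete_vertex /remove_edge /far /= eab av bv.
have up : u = p.
  apply: (@tree_neighbour_unique v); rewrite 1?esym //.
  rewrite delete_vertex_csym in cyu; apply: connect_trans cyu _.
  apply: connect_trans cyw _; apply: connect_trans ccp.
  by rewrite delete_vertex_csym.
by rewrite up pb in ub.
Qed.

(** This puts a whole branch below [v] into one class of level [i.+1], so that saturated sets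
    contain the branches they meet. *)
Lemma branch_connect i v y z : v \notin ball i -> v \in ball i.+1 ->
  connect (far i) v y -> y != v -> connect (delete_vertex e v) y z ->
  connect (far i.+1) y z.
Proof.
move=> vb vb1 cvy yv cyz.
have h w : connect (delete_vertex e v) y w -> w \notin ball i.+1.
  exact: branch_far.
apply: connect_sub (connect_restrict h cyz) => a b /andP[/andP[/andP[/andP[eab _] _] ha] hb].
by apply: connect1; rewrite /delete_vertex /remove_edge /far /= eab ha hb.
Qed.

Lemma level_vertex i n w : w \notin ball i -> w \in ball n ->
  exists v, [/\ v \notin ball i, v \in ball i.+1 & connect (far i) w v].
Proof.
elim: n w => [|n IH] w wi; first by rewrite inE.
have [w1 _|w1] := boolP (w \in ball i.+1); first by exists w.
case/ball_inv => [wc|[u ub euw]]; first by case/negP: w1; rewrite wc /= !inE eqxx.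
have ui : u \notin ball i by apply: contra w1 => /ball_step/(_ euw).
have [v [v1 v2 v3]] := IH u ui ub; exists v; split=> //.
by apply: connect_trans v3; apply: connect1; rewrite /delete_vertex /remove_edge /far /= esym euw ui wi.
Qed.

Lemma far_isolated i w y : w \in ball i -> connect (far i) w y -> w = y.
Proof.
move=> wb /connectP[[|a q] /=]; first by move=> _ ->.
by rewrite /far /= wb andbF.
Qed.

End Graph.

(** * From branch-decompositions to layouts *)

(** Radius [d] puts every vertex in [ball d.+1], so classes are singletons at level [d.+1]. The
    maximum with 1 covers cuts at leaves and at isolated vertices, where one side has at most one
    element. *)
Lemma decomposition_layout (M : matroid) d r : decomposition M d r ->
  layout (rk M) [set: elt M] d.+1 (maxn r 1).
Proof.
case=> V [e [f [tree [c rad] injf leafE lam]]].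
have max := rk_ax M.
have inball w : w \in ball e c d.+1.
  have [p [pp <- sp]] := rad w.
  have c1 : c \in ball e c 1 by rewrite /= !inE eqxx.
  have h := ball_path c1 pp; rewrite add1n in h.
  by move/leP: sp; elim=> // m _; apply: ballS.
pose a i x := pickle (fingraph.root (far e c i) (f x)).
have aE i x y : a i x = a i y <-> connect (far e c i) (f x) (f y).
  rewrite -(root_connect (far_csym tree c i)); split=> [/(pcan_inj pickleK) ->//|/eqP].
  by rewrite /a => ->.
exists a; split.
- move=> x y _ _; apply/aE.
  apply: connect_sub (_ : connect e (f x) (f y)); last by case: tree.
  by move=> u v euv; apply: connect1; rewrite /delete_vertex /remove_edge /far /= euv !inE.
- move=> i x y _ _ /aE h; apply/aE; apply: connect_sub h => u v /andP[/andP[euv ub] vb].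
  by apply: connect1; rewrite /delete_vertex /remove_edge /far /= euv; apply/andP; split; [move: ub|move: vb];
     apply: contra; apply: ballS.
- move=> x y _ _ /aE h; apply: injf; apply: far_isolated h.
  exact: inball.
move=> i Z _ _ hZ sat; rewrite setTD.
have small (A B : {set elt M}) x0 : A \subset [set x0] -> lambda (rk M) A B <= maxn r 1.
  move=> sA; apply: leq_trans (lambda_le_card max _ _) _.
  apply: leq_trans (subset_leq_card sA) _; rewrite cards1; exact: leq_maxr.
have [->|[x xZ]] := set_0Vmem Z; first by rewrite lambda_set0.
have [xb|xb] := boolP (f x \in ball e c i).
  apply: (small _ _ x); apply/subsetP => y yZ; rewrite inE; apply/eqP/esym/injf.
  by apply: far_isolated xb _; apply/aE/hZ.
have [v [v1 v2 v3]] := level_vertex tree xb (inball _).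
have vZ y : y \in Z -> connect (far e c i) v (f y).
  move=> yZ; rewrite far_csym // in v3; apply: connect_trans v3 _.
  exact/aE/hZ.
pose J := [set u : nbr e v | [exists y in Z, connect (delete_vertex e v) (val u) (f y)]].
have nbrN (u : nbr e v) : val u != v.
  apply/eqP => uv; have := valP u; rewrite uv; case: tree => _ _ irr _ _.
  by rewrite irr.
have compJ (u : nbr e v) z : u \in J -> z \in comp_elts f u -> z \in Z.
  rewrite !inE => /existsP[y /andP[yZ cy]] cz.
  apply: (sat y z) => //; apply/aE.
  apply: (branch_connect tree v1 v2); first exact: vZ.
    exact: connect_delete_neq cy (nbrN u).
  by apply: connect_trans cz; rewrite delete_vertex_csym.
have compJC (u : nbr e v) z : u \notin J -> z \in comp_elts f u -> z \notin Z.
  move=> uJ; rewrite inE => cz; apply: contra uJ => zZ.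
  by rewrite inE; apply/existsP; exists z; rewrite zZ.
(* A leaf has at most one neighbour, so apart from its own element either none or all of the
   elements lie in [Z]. *)
have [lv|lv] := boolP (leaf e v).
  have := lv; rewrite leafE => /codomP[x0 vx0].
  have other y : y != x0 -> exists u : nbr e v, y \in comp_elts f u.
    move=> yx; have fy : f y != v by rewrite vx0 (inj_eq injf).
    by have [u cu] := delete_vertex_cover tree fy; exists u; rewrite inE.
  have nbr1 (u u' : nbr e v) : u = u'.
    apply: val_inj; have /card_le1_eqP := lv; apply; rewrite inE; exact: valP.
  have [J0|[u uJ]] := set_0Vmem J.
    apply: (small _ _ x0); apply/subsetP => y yZ; rewrite inE; apply/negPn/negP.
    by case/other => u cu; have := compJC u y; rewrite J0 inE cu yZ => /(_ isT isT).
  rewrite lambdaC; apply: (small _ _ x0); apply/subsetP => y; rewrite !inE => yZ.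
  apply/negPn/negP => /other[u' cu']; case/negP: yZ; apply: (compJ u') => //.
  by rewrite (nbr1 u' u).
have fN y : f y != v by apply: contraNneq lv => <-; rewrite leafE codom_f.
have cov y : exists u : nbr e v, y \in comp_elts f u.
  by have [u cu] := delete_vertex_cover tree (fN y); exists u; rewrite inE.
have EZ : Z = \bigcup_(u in J) comp_elts f u.
  apply/setP => y; apply/idP/bigcupP => [yZ|[u]]; last exact: compJ.
  have [u cu] := cov y; exists u => //; apply/negPn/negP => uJ.
  by have := compJC u y uJ cu; rewrite yZ.
have EZC : ~: Z = \bigcup_(u in ~: J) comp_elts f u.
  apply/setP => y; rewrite inE; apply/idP/bigcupP => [yZ|[u]].
    have [u cu] := cov y; exists u => //; rewrite inE; apply: contra yZ => uJ.
    exact: compJ uJ cu.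
  by rewrite inE; apply: compJC.
apply: leq_trans (leq_maxl _ _); apply: leq_trans (lam v lv).
rewrite EZC [X in lambda _ X _]EZ /lambda_star.
exact: (leq_bigmax (F := fun J : {set nbr e v} => lambda (rk M)
  (\bigcup_(i in J) comp_elts f i) (\bigcup_(i in ~: J) comp_elts f i))).
Qed.

Lemma connect_invariant (V : finType) (R : rel V) (P : pred V) x y :
  (forall u v, R u v -> P u -> P v) -> P x -> connect R x y -> P y.
Proof.
move=> h Px /connectP[p]; elim: p x Px => [|z p IH] x Px /=; first by move=> _ ->.
by case/andP=> Rxz pp lp; apply: IH pp lp; apply: h Px.
Qed.

Lemma remove_edge_sym (V : finType) (e : rel V) a b :
  symmetric e -> symmetric (remove_edge e a b).
Proof.
move=> se x y; rewrite /remove_edge /= se.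
by case: (e y x) => //=; case: (x == a); case: (y == b); case: (x == b); case: (y == a).
Qed.

Lemma remove_edgeC (V : finType) (e : rel V) a b : remove_edge e a b =2 remove_edge e b a.
Proof. by move=> x y; rewrite /remove_edge /= andbAC. Qed.

(** * From layouts to branch-decompositions *)

Section LayoutTree.
Variables (T : finType) (D : nat) (a : nat -> T -> nat).
Hypothesis a_const : forall x y, a 0 x = a 0 y.
Hypothesis a_refine : forall i x y, a i.+1 x = a i.+1 y -> a i x = a i y.

Definition rep i x := odflt x [pick y | a i y == a i x].

Lemma rep_label i x : a i (rep i x) = a i x.
Proof. by rewrite /rep; case: pickP => [y /eqP|]. Qed.

Lemma rep_eq i x y : a i x = a i y -> rep i x = rep i y.
Proof.
rewrite /rep => e; have -> : [pick z | a i z == a i x] = [pick z | a i z == a i y].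
  by apply: eq_pick => z; rewrite e.
by case: pickP => [//|/(_ y)]; rewrite eqxx.
Qed.

Lemma a_refine_le i j x y : i <= j -> a j x = a j y -> a i x = a i y.
Proof.
move=> le; rewrite -(subnK le); elim: (j - i) => [//|n IH] h.
exact/IH/a_refine.
Qed.

(* The nodes at level [i] are the classes of [a i], each given by a
   representative. *)
Definition node := {p : 'I_D.+1 * T | rep p.1 p.2 == p.2}.
Definition lev (u : node) : nat := (val u).1.
Definition pt (u : node) : T := (val u).2.

Lemma rep_idem (i : 'I_D.+1) x : rep (i, rep i x).1 (i, rep i x).2 == (i, rep i x).2.
Proof. by apply/eqP/rep_eq/rep_label. Qed.

Definition node_at (i : 'I_D.+1) x : node := Sub (i, rep i x) (rep_idem i x).

Lemma lev_node_at i x : lev (node_at i x) = i.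
Proof. by []. Qed.

Lemma pt_node_at (i : 'I_D.+1) x : a i (pt (node_at i x)) = a i x.
Proof. exact: rep_label. Qed.

Lemma lev_le u : lev u <= D.
Proof. by rewrite -ltnS; apply: ltn_ord. Qed.

Lemma node_ext u w : lev u = lev w -> a (lev u) (pt u) = a (lev u) (pt w) -> u = w.
Proof.
case: u => [[i x] /= hx]; case: w => [[j y] /= hy]; rewrite /lev /pt /= => ij e.
apply: val_inj => /=; have eij : i = j by apply: val_inj.
rewrite -eij in hy *; congr (_, _).
by rewrite -(eqP hx) -(eqP hy); apply: rep_eq.
Qed.

Lemma node_atK u : node_at (inord (lev u)) (pt u) = u.
Proof.
have l : lev (node_at (inord (lev u)) (pt u)) = lev u.
  by rewrite lev_node_at inordK // ltnS lev_le.
by apply: node_ext; rewrite // pt_node_at.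
Qed.

Definition child (u w : node) :=
  (lev w == (lev u).+1) && (a (lev u) (pt w) == a (lev u) (pt u)).
Definition adj : rel node := [rel u w | child u w || child w u].
Definition desc (u w : node) :=
  (lev u <= lev w) && (a (lev u) (pt w) == a (lev u) (pt u)).

Lemma child_uniq u u' w : child u w -> child u' w -> u = u'.
Proof.
case/andP=> /eqP l /eqP h /andP[/eqP l' /eqP h'].
have ll : lev u = lev u' by rewrite l' in l; case: l.
by apply: node_ext => //; rewrite -h ll h'.
Qed.

(** The only edge leaving the descendants of [b] leads from [b] to its parent. This yields both
    acyclicity and the components left by deleting a vertex. *)
Lemma desc_step b w w' : adj w w' -> desc b w ->
  desc b w' \/ w = b /\ child w' b.
Proof.
rewrite /adj /= /desc => /orP[/andP[/eqP l /eqP h]|cw] /andP[lb /eqP hb].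
  left; rewrite l ltnW ?ltnS //=.
  by rewrite (a_refine_le lb h) hb.
case/andP: (cw) => /eqP l /eqP h.
have [lbw|lbw] := leqP (lev b) (lev w').
  by left; rewrite /= -(a_refine_le lbw h) hb.
have wb : w = b.
  have lw : lev w = lev b by lia.
  by apply: node_ext; rewrite // lw.
by right; rewrite -{2}wb.
Qed.

Lemma adj_sym : symmetric adj.
Proof. by move=> u w; rewrite /adj /= orbC. Qed.

Lemma child_node_at (i : nat) x (hi : i < D.+1) (hj : i.+1 < D.+1) :
  child (node_at (Ordinal hi) x) (node_at (Ordinal hj) x).
Proof.
rewrite /child !lev_node_at /= eqxx /=.
have h : a i.+1 (pt (node_at (Ordinal hj) x)) = a i.+1 x := pt_node_at (Ordinal hj) x.
by rewrite (a_refine h) [X in _ == X](pt_node_at (Ordinal hi) x).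
Qed.

Variable x0 : T.
Let c : node := node_at ord0 x0.

Lemma root_eq u : lev u = 0 -> u = c.
Proof. by move=> l; apply: node_ext; rewrite l. Qed.

Lemma root_path u : exists p : seq node, [/\ path adj c p, last c p = u & size p = lev u].
Proof.
rewrite -(node_atK u); set x := pt u; set i := lev u.
have : i < D.+1 by rewrite ltnS lev_le.
elim: i => [|i IH] hi.
  by exists [::]; split=> //=; [apply/esym/root_eq|]; rewrite lev_node_at inordK.
have hi' : i < D.+1 by apply: ltnW.
have [p [pp lp sp]] := IH hi'.
exists (rcons p (node_at (inord i.+1) x)); split.
- rewrite rcons_path pp lp /=; apply/orP; left.
  have -> : inord i = Ordinal hi' by apply: val_inj; rewrite /= inordK.
  have -> : inord i.+1 = Ordinal hi by apply: val_inj; rewrite /= inordK.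
  exact: child_node_at.
- by rewrite last_rcons.
- by rewrite size_rcons sp !lev_node_at !inordK.
Qed.

Lemma adj_is_tree : is_tree adj.
Proof.
have cs : connect_sym adj by apply/sym_connect_sym/adj_sym.
have cc u : connect adj c u.
  by have [p [pp <- _]] := root_path u; apply/connectP; exists p.
split.
- by apply/card_gt0P; exists c.
- exact: adj_sym.
- move=> u; rewrite /adj /= /child orbb.
  by rewrite (ltn_eqF (ltnSn _)).
- by move=> u w; apply: connect_trans (cc w); rewrite cs.
have main u w : child u w -> ~~ connect (remove_edge adj u w) w u.
  move=> cuw; apply/negP => con.
  have : desc w u.
    apply: connect_invariant con; last by rewrite /desc leqnn eqxx.
    move=> v y /andP[/andP[ev n1] n2] dv; case: (desc_step ev dv) => [//|[vw cy]].
    by rewrite vw (child_uniq cuw cy) !eqxx in n2.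
  by case/andP: cuw => /eqP l _; rewrite /desc l ltnn.
have rsym u w : connect_sym (remove_edge adj u w).
  exact/sym_connect_sym/remove_edge_sym/adj_sym.
move=> u w /orP[cuw|cwu]; first by rewrite rsym; apply: main.
by have := main _ _ cwu; rewrite (eq_connect (remove_edgeC adj w u)).
Qed.

Lemma child_delete u v x : child v u ->
  connect (delete_vertex adj v) u (node_at ord_max x) = (a (lev u) x == a (lev u) (pt u)).
Proof.
move=> cvu; have ml : a (lev u) (pt (node_at ord_max x)) = a (lev u) x.
  by apply: (@a_refine_le _ D); rewrite ?lev_le //; apply: (pt_node_at ord_max).
apply/idP/idP => [con|/eqP ex].
  have : desc u (node_at ord_max x).
    apply: connect_invariant con; last by rewrite /desc leqnn eqxx.
    move=> w y /andP[/andP[ew n1] n2] dw; case: (desc_step ew dw) => [//|[wu cy]].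
    by rewrite (child_uniq cy cvu) eqxx in n2.
  by case/andP => _; rewrite ml.
(* Conversely, the nodes above [x] from level [lev u] downwards form a path, which avoids [v]
   because [v] has a smaller level. *)
have main n : lev u + n < D.+1 -> connect (delete_vertex adj v) u (node_at (inord (lev u + n)) x).
  elim: n => [|n IH]; rewrite ?addn0 ?addnS => hn.
    suff -> : node_at (inord (lev u)) x = u by [].
    apply: node_ext; first by rewrite lev_node_at inordK.
    by rewrite pt_node_at lev_node_at inordK.
  have hn' : lev u + n < D.+1 by apply: ltnW.
  apply: connect_trans (IH hn') _; apply: connect1.
  have lv : lev v < lev u by case/andP: cvu => /eqP -> _.
  have nv k : lev u + k < D.+1 -> node_at (inord (lev u + k)) x != v.
    move=> hk; apply/eqP => e; move: (lev_node_at (inord (lev u + k)) x); rewrite e.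
    by rewrite inordK // => e'; move: lv; rewrite e' ltnNge leq_addr.
  have n1 := nv n hn'; have n2 : node_at (inord (lev u + n).+1) x != v.
    by rewrite -addnS; apply: nv; rewrite addnS.
  apply/andP; split; [apply/andP; split|] => //; apply/orP; left.
  have -> : inord (lev u + n) = Ordinal hn' by apply: val_inj; rewrite /= inordK.
  have -> : inord (lev u + n).+1 = Ordinal hn by apply: val_inj; rewrite /= inordK.
  exact: child_node_at.
have := main (D - lev u); rewrite subnKC ?lev_le // => /(_ (ltnSn _)).
by have -> : inord D = ord_max :> 'I_D.+1 by apply: val_inj; rewrite /= inordK.
Qed.

(** With a single class at level 1, the root of a tree of positive depth would have degree one and
    count as a leaf carrying no element. *)
Hypothesis a_split : exists x y, a 1 x <> a 1 y.

Lemma adj_leaf u : leaf adj u = (lev u == D).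
Proof.
apply/idP/eqP => [/card_le1_eqP h|l]; last first.
  apply/card_le1_eqP => w w'; rewrite !inE.
  have nc z : child u z = false.
    apply/negP => /andP[/eqP e _]; have := lev_le z; rewrite e l; lia.
  by rewrite /adj /= !nc /= => h1 h2; apply: child_uniq h2 h1.
apply/eqP; rewrite eqn_leq lev_le leqNgt; apply/negP => lt.
have hi : lev u < D.+1 by apply: ltnW.
have hj : (lev u).+1 < D.+1 by [].
have chi x : a (lev u) x = a (lev u) (pt u) -> child u (node_at (Ordinal hj) x).
  move=> e; have := child_node_at x hi hj.
  suff -> : node_at (Ordinal hi) x = u by [].
  by apply: node_ext; rewrite // lev_node_at pt_node_at.
have [l0|l0] := posnP (lev u).
  case: a_split => x [y nxy]; apply: nxy.
  have cx : child u (node_at (Ordinal hj) x) by apply: chi; rewrite l0.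
  have cy : child u (node_at (Ordinal hj) y) by apply: chi; rewrite l0.
  have := h (node_at (Ordinal hj) x) (node_at (Ordinal hj) y).
  rewrite !inE /adj /= cx cy => /(_ isT isT) e.
  have e1 : a (lev u).+1 x = a (lev u).+1 y.
    rewrite -[LHS](pt_node_at (Ordinal hj) x) -e; exact: (pt_node_at (Ordinal hj) y).
  by rewrite l0 in e1.
have cx := chi (pt u) erefl.
have hp : (lev u).-1 < D.+1 by lia.
have cp : child (node_at (Ordinal hp) (pt u)) u.
  have hp' : (lev u).-1.+1 < D.+1 by rewrite prednK.
  have := child_node_at (pt u) hp hp'.
  suff -> : node_at (Ordinal hp') (pt u) = u by [].
  by apply: node_ext; rewrite ?pt_node_at lev_node_at /= prednK.
have := h (node_at (Ordinal hj) (pt u)) (node_at (Ordinal hp) (pt u)).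
rewrite !inE /adj /= cx cp orbT => /(_ isT isT) e.
have := lev_node_at (Ordinal hj) (pt u); rewrite -e lev_node_at /=; lia.
Qed.

End LayoutTree.

Lemma layout_decomposition (M : matroid) D w : 0 < #|elt M| ->
  layout (rk M) [set: elt M] D w -> exists2 D', D' <= D & decomposition M D' w.
Proof.
move=> /card_gt0P[x0 _] [a [a0 aS aD aw]]; have rax := rk_ax M.
have [one|two] := leqP #|elt M| 1.
  exists 0 => //; exists unit, (fun _ _ => false), (fun=> tt); split.
  - by split=> //; [rewrite card_unit|case; case; apply: connect0].
  - by exists tt => -[]; exists [::].
  - by move=> x y _; have /card_le1_eqP := one; apply.
  - move=> []; rewrite /leaf /degree.
    have -> : [set u : unit | false] = set0 by apply/setP => u; rewrite !inE.
    by rewrite cards0; apply/esym/codomP; exists x0.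
  - move=> v; rewrite /leaf /degree.
    have -> : [set u : unit | false] = set0 by apply/setP => u; rewrite !inE.
    by rewrite cards0.
elim: D a a0 aS aD aw => [|D IH] a a0 aS aD aw.
  exfalso; move: two; rewrite ltnNge => /negP; apply; apply/card_le1_eqP => x y _ _.
  by apply: aD; rewrite ?inE //; apply: a0; rewrite inE.
(* A top level that splits nothing is dropped, which is why the depth may shrink. *)
have [/existsP[x /existsP[y nxy]]|cst] := boolP [exists x, exists y, a 1 x != a 1 y]; last first.
  have [|i|||D' D'D dec] := IH (fun i => a i.+1).
  - move=> x y _ _; apply/eqP/negPn/negP => n; case/negP: cst.
    by apply/existsP; exists x; apply/existsP; exists y.
  - exact: aS.
  - exact: aD.
  - by move=> i Z iD; apply: aw.
  by exists D' => //; apply: leqW.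
exists D.+1 => //.
have a_const u v : a 0 u = a 0 v by apply: a0; rewrite inE.
have a_refine i u v : a i.+1 u = a i.+1 v -> a i u = a i v by apply: aS; rewrite inE.
have a_inj : injective (a D.+1) by move=> u v; apply: aD; rewrite inE.
have {x y nxy}a_split : exists x y, a 1 x <> a 1 y by exists x, y; apply/eqP.
pose V : finType := node D.+1 a; pose f := @node_at _ D.+1 a ord_max : elt M -> V.
have tree := adj_is_tree D.+1 a_const a_refine x0.
exists V, (@adj _ D.+1 a), f; split=> //.
- exists (node_at a ord0 x0) => u; have [p [pp lp sp]] := root_path a_const a_refine x0 u.
  by exists p; split=> //; rewrite sp lev_le.
- move=> u v e; apply: a_inj; have := @pt_node_at _ D.+1 a ord_max u.
  by have := @pt_node_at _ D.+1 a ord_max v; rewrite -/(f v) -e => <- <-.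
- move=> u; rewrite adj_leaf //; apply/eqP/codomP => [l|[z ->]] //.
  by exists (pt u); apply: node_ext; rewrite l //; apply/esym/(@pt_node_at _ D.+1 a ord_max).
move=> v; rewrite adj_leaf // => lv.
have lt : lev v < D.+1 by rewrite ltn_neqAle lv lev_le.
set C := comp_elts f (v := v).
(* Unions of child branches are saturated. If [J] contains the parent, its complement consists of
   children, and [lambda] is symmetric. *)
have main (J : {set nbr (@adj _ D.+1 a) v}) : (forall u, u \in J -> child v (val u)) ->
    lambda (rk M) (\bigcup_(i in J) C i) (\bigcup_(i in ~: J) C i) <= w.
  move=> Jc; set Z := \bigcup_(i in J) C i.
  have CE u y : u \in J -> (y \in C u) = (a (lev v).+1 y == a (lev v).+1 (pt (val u))).
    move=> uJ; rewrite inE child_delete //; last exact: Jc.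
    by have /andP[/eqP -> _] := Jc u uJ.
  apply: leq_trans (_ : lambda (rk M) Z ([set: elt M] :\: Z) <= w).
    apply: lambdaE_mono => //; rewrite setTD; apply/bigcupsP => u uJ.
    apply/subsetP => y yu; rewrite inE; apply/negP => /bigcupP[u' uJ' yu'].
    suff e : u = u' by move: uJ; rewrite inE e uJ'.
    apply: val_inj; apply: (tree_neighbour_unique tree (valP u) (valP u')).
    rewrite !inE in yu yu'; apply: connect_trans yu _.
    by rewrite (delete_vertex_csym tree).
  apply: (aw (lev v)) => //.
    have hv y : y \in Z -> a (lev v) y = a (lev v) (pt v).
      case/bigcupP => u uJ; rewrite CE // => /eqP/a_refine ->.
      by have /andP[_ /eqP] := Jc u uJ.
    by move=> y z /hv -> /hv ->.
  move=> y z /bigcupP[u uJ]; rewrite CE // => /eqP yu _ e.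
  by apply/bigcupP; exists u => //; rewrite CE // -e yu.
apply/bigmax_leqP => J _.
have [/existsP[u /andP[uJ nu]]|] := boolP [exists u in J, ~~ child v (val u)].
  rewrite lambdaC -{2}(setCK J); apply: main => u'; rewrite inE => uJ'.
  have := valP u'; rewrite /adj /= => /orP[//|cu'].
  have cu : child (val u) v by have := valP u; rewrite /adj /= (negPf nu).
  have e : u = u' by apply: val_inj; apply: child_uniq cu cu'.
  by rewrite -e uJ in uJ'.
rewrite negb_exists => /forallP h; apply: main => u uJ.
by have := h u; rewrite uJ /= negbK.
Qed.

(** * Matrices with bounded off-diagonal ranks *)

Import GRing.Theory.
Local Open Scope ring_scope.

Section Blocks.
Variables (F : fieldType) (n : nat).
Implicit Types (P Q X Z : {set 'I_n}) (A B L : 'M[F]_n).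

Definition cmask Q : 'M[F]_n := diag_mx (\row_j (j \in Q)%:R).
(** Blocks keep the full size, padded with zeros, so that blocks on different index sets can be
    added and compared. *)
Definition blk P Q A : 'M[F]_n := \matrix_(i, j) if (i \in P) && (j \in Q) then A i j else 0.

Lemma blkE P Q A : blk P Q A = cmask P *m A *m cmask Q.
Proof.
apply/matrixP => i j; rewrite mul_mx_diag mul_diag_mx !mxE.
by case: (i \in P); case: (j \in Q); rewrite ?mul1r ?mulr1 ?mul0r ?mulr0.
Qed.

Lemma blk_blk P Q P' Q' A : P' \subset P -> Q' \subset Q ->
  blk P' Q' (blk P Q A) = blk P' Q' A.
Proof.
move=> sP sQ; apply/matrixP => i j; rewrite !mxE.
by case: ifP => // /andP[iP jQ]; rewrite (subsetP sP) ?(subsetP sQ).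
Qed.

Lemma rankD_le A B : (\rank (A + B)%R <= \rank A + \rank B)%N.
Proof. exact: mxrank_add. Qed.

Lemma rank_blk P Q A : (\rank (blk P Q A) <= \rank A)%N.
Proof.
rewrite blkE; apply: leq_trans (mxrankM_maxl _ _) _; exact: mxrankM_maxr.
Qed.

Lemma rank_blkS P Q P' Q' A : P' \subset P -> Q' \subset Q ->
  (\rank (blk P' Q' A) <= \rank (blk P Q A))%N.
Proof. by move=> sP sQ; rewrite -(blk_blk A sP sQ); apply: rank_blk. Qed.

Lemma blkD P Q A B : blk P Q (A + B) = blk P Q A + blk P Q B.
Proof. by rewrite !blkE mulmxDr mulmxDl. Qed.

Lemma rank_cmask_le X : (\rank (cmask X) <= #|X|)%N.
Proof.
have -> : cmask X = \sum_(x in X) delta_mx x x.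
  apply/matrixP => i j; rewrite summxE !mxE.
  have [iX|iX] := boolP (i \in X); last first.
    rewrite big1 => [|x xX]; first by case: eqVneq => // <-; rewrite (negPf iX) mulr0n.
    by rewrite mxE; case: eqVneq => // e; rewrite e xX in iX.
  rewrite (bigD1 i) //= big1 ?addr0 => [|x /andP[_ /negPf nx]].
    by rewrite mxE eqxx eq_sym /=; case: eqVneq => // ->; rewrite iX.
  by rewrite mxE eq_sym nx.
rewrite -sum1_card; apply: (big_ind2 (fun (L : 'M[F]_n) m => \rank L <= m)%N).
- by rewrite mxrank0.
- by move=> L1 m1 L2 m2 h1 h2; apply: leq_trans (rankD_le _ _) (leq_add h1 h2).
- by move=> x _; rewrite mxrank_delta.
Qed.

Lemma rank_cmask X : \rank (cmask X) = #|X|.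
Proof.
apply/eqP; rewrite eqn_leq rank_cmask_le /=.
have e : cmask X + cmask (~: X) = 1%:M.
  apply/matrixP => i j; rewrite !mxE inE; case: eqVneq => [->|_]; last by rewrite !mulr0n addr0.
  by case: (j \in X); rewrite /= ?addr0 ?add0r.
have := rankD_le (cmask X) (cmask (~: X)); rewrite e mxrank1.
have := rank_cmask_le (~: X); have := cardsC X; rewrite card_ord.
by move: (\rank _) (\rank _) #|_| #|_|; lia.
Qed.

(** The new row space lies in that of [B], and strictly so: column [j] of the new matrix is zero,
    while row [i] of [B] is nonzero there. *)
Lemma rank_pivot B i j : B i j != 0 ->
  (\rank (B - (B i j)^-1 *: (col j B *m row i B))%R < \rank B)%N.
Proof.
move=> Bij; set B' := B - _.
have sB' : (B' <= B)%MS.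
  rewrite /B' rowE mulmxA scalemxAl -mulNmx -{1}(mul1mx B) -mulmxDl.
  exact: submxMl.
have cB' : B' *m delta_mx j 0 = 0 :> 'cV_n.
  rewrite -colE; apply/matrixP => k l; rewrite !mxE big_ord1 !mxE.
  by rewrite mulrC -mulrA divff // mulr1 subrr.
rewrite ltnNge; apply/negP => le.
have := mxrank_leqif_sup sB' => -[le1 /esym]; rewrite (eqn_leq (\rank B')) le le1 /= => sB.
have /submxP[D e] := submx_trans (row_sub i B) sB.
have : (row i B *m delta_mx j 0 : 'M_1) 0 0 = 0 by rewrite e -mulmxA cB' mulmx0 mxE.
by rewrite -colE !mxE => /eqP; apply/negP.
Qed.

Definition saturated (a : 'I_n -> nat) X Z :=
  {in Z & X, forall y z, a y = a z -> z \in Z}.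

(** One pivot step pays for four blocks of rank at most [r] along the two pivot classes, and 1 for
    the pivot term. *)
Fixpoint glr (r : nat) : nat := if r is s.+1 then glr s + (4 * r).+1 else 0.

(* Pivoting on an entry between
   two classes lowers the off-diagonal ranks among the remaining classes, and
   the two classes themselves only contribute bounded rank. *)
Lemma block_low_rank r X (a : 'I_n -> nat) A :
  (forall Z, Z \subset X -> saturated a X Z -> (\rank (blk Z (X :\: Z) A) <= r)%N) ->
  exists2 L, (\rank L <= glr r)%N &
    {in X &, forall i j, a i <> a j -> L i j = A i j}.
Proof.
elim: r X A => [|r IH] X A H.
  exists 0; first by rewrite mxrank0.
  move=> i j iX jX aij; pose Z := [set x in X | a x == a i].
  have sZ : Z \subset X by apply/subsetP => x; rewrite inE => /andP[].
  have := H Z sZ; rewrite leqn0 mxrank_eq0 => h.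
  have /h/eqP/matrixP/(_ i j) : saturated a X Z.
    by move=> y z; rewrite !inE => /andP[_ /eqP e] zX e'; rewrite zX -e' e eqxx.
  by rewrite !mxE !inE iX jX eqxx /= (introF eqP (nesym aij)) /= => ->.
have [/existsP[i0 /existsP[j0 /and4P[iX jX /eqP aij nz]]]|none] :=
    boolP [exists i, exists j, [&& i \in X, j \in X, a i != a j & A i j != 0]]; last first.
  exists 0; first by rewrite mxrank0.
  move=> i j iX jX /eqP aij; rewrite mxE; apply/esym/eqP/negPn/negP => nz.
  by case/negP: none; apply/existsP; exists i; apply/existsP; exists j; apply/and4P.
pose ci := [set x in X | a x == a i0]; pose cj := [set x in X | a x == a j0].
pose X' := X :\: (ci :|: cj).
pose piv : 'M[F]_n := (A i0 j0)^-1 *: (col j0 A *m row i0 A).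
have sci : ci \subset X by apply/subsetP => x; rewrite inE => /andP[].
have scj : cj \subset X by apply/subsetP => x; rewrite inE => /andP[].
have satci : saturated a X ci.
  by move=> y z; rewrite !inE => /andP[_ /eqP e] zX e'; rewrite zX -e' e eqxx.
have satcj : saturated a X cj.
  by move=> y z; rewrite !inE => /andP[_ /eqP e] zX e'; rewrite zX -e' e eqxx.
have satC Z : saturated a X Z -> saturated a X (X :\: Z).
  move=> sat y z; rewrite !inE => /andP[yZ yX] zX e; rewrite zX andbT.
  by apply: contra yZ => zZ; apply: (sat z y).
have dij x : x \in ci -> x \in cj = false.
  by rewrite !inE => /andP[_ /eqP ->]; rewrite (introF eqP aij) andbF.
have i0ci : i0 \in ci by rewrite inE iX eqxx.
have j0cj : j0 \in cj by rewrite inE jX eqxx.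
have [|L rL HL] := IH X' (A - piv).
  (* With the class of [i0] joined to [Z] and the class of [j0] on the other side, the pivot lies
     inside a block of rank at most [r.+1]. Pivoting lowers that rank, and the block of [Z] is a
     part of the result. *)
  move=> Z sZ sat; pose Z1 := Z :|: ci.
  have sZX : Z \subset X by apply: subset_trans sZ (subsetDl _ _).
  have sZ1 : Z1 \subset X by rewrite subUset sZX.
  have sat1 : saturated a X Z1.
    move=> y z; rewrite !(in_setU _ Z ci) => /orP[yZ|yc] zX e; last by rewrite (satci y z) ?orbT.
    have := subsetP sZ y yZ; rewrite !inE negb_or => /andP[/andP[yi yj] yX].
    apply/orP; left; apply: (sat y z) => //.
    by rewrite /X' !inE zX andbT -e negb_or; move: yi yj; rewrite yX /= => -> ->.
  pose B := blk Z1 (X :\: Z1) A.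
  have jZ1 : j0 \in X :\: Z1.
    rewrite inE jX andbT in_setU negb_or; apply/andP; split.
      by apply/negP => /(subsetP sZ); rewrite !in_setD in_setU j0cj orbT.
    by apply/negP => /dij; rewrite j0cj.
  have iZ1 : i0 \in Z1 by rewrite in_setU i0ci orbT.
  have Bij : B i0 j0 = A i0 j0 by rewrite mxE iZ1 jZ1.
  have rB : (\rank B <= r.+1)%N by apply: H.
  have nzB : B i0 j0 != 0 by rewrite Bij.
  have := rank_pivot nzB; set B' := B - _ => rB'.
  have -> : blk Z (X' :\: Z) (A - piv) = blk Z (X' :\: Z) B'.
    apply/matrixP => i j; rewrite [LHS]mxE [RHS]mxE; case: ifP => // /andP[iZ jZ].
    have iZ' : i \in Z1 by rewrite in_setU iZ.
    have jZ' : j \in X :\: Z1.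
      move: jZ; rewrite !in_setD !in_setU !negb_or => /andP[-> /andP[/andP[-> _] ->]] //.
    rewrite /B' /piv Bij !mxE !big_ord1 !mxE.
    by rewrite iZ' jZ' iZ1 jZ1.
  by apply: leq_trans (rank_blk _ _ _) _; rewrite -ltnS; apply: leq_trans rB' rB.
(* The supports are disjoint: [L2] and [L3] serve the pairs with exactly one index in [ci], [L4] and
   [L5] those with exactly one in [cj] and none in [ci], and [L1] restores the pivot term on
   [X']. *)
pose Y := X :\: ci.
pose L1 := blk X' X' (L + piv).
pose L2 := blk ci Y A; pose L3 := blk Y ci A.
pose L4 := blk cj (Y :\: cj) A; pose L5 := blk (Y :\: cj) cj A.
exists (L1 + (L2 + L3 + (L4 + L5))).
  have r1 : (\rank L1 <= glr r + 1)%N.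
    apply: leq_trans (rank_blk _ _ _) _; apply: leq_trans (rankD_le _ _) _.
    apply: leq_add rL _; apply: leq_trans (mxrank_scale _ _) _.
    by apply: leq_trans (mxrankM_maxl _ _) _; apply: rank_leq_col.
  have r2 : (\rank L2 <= r.+1)%N by apply: H.
  have r3 : (\rank L3 <= r.+1)%N.
    have -> : L3 = blk Y (X :\: Y) A.
      by rewrite /L3 /Y; congr (blk _ _ _); rewrite setDDr setDv set0U (setIidPr sci).
    by apply: H (satC _ satci); apply: subsetDl.
  have r4 : (\rank L4 <= r.+1)%N.
    apply: leq_trans (H cj scj satcj); apply: rank_blkS => //.
    by apply: setSD; apply: subsetDl.
  have r5 : (\rank L5 <= r.+1)%N.
    have e : cj = X :\: (X :\: cj) by rewrite setDDr setDv set0U (setIidPr scj).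
    apply: leq_trans (H (X :\: cj) (subsetDl _ _) (satC _ satcj)).
    by rewrite -e; apply: rank_blkS => //; apply: setSD; apply: subsetDl.
  have := rankD_le L1 (L2 + L3 + (L4 + L5)); have := rankD_le (L2 + L3) (L4 + L5).
  have := rankD_le L2 L3; have := rankD_le L4 L5.
  by rewrite /=; move: r1 r2 r3 r4 r5; clear; lia.
move=> i j iX' jX' naij; rewrite !mxE.
have mX' x : x \in X -> (x \in X') = (x \notin ci) && (x \notin cj).
  by move=> xX; rewrite in_setD in_setU xX andbT negb_or.
have mY x : x \in X -> (x \in Y) = (x \notin ci) by move=> xX; rewrite in_setD xX andbT.
have mYj x : x \in X -> (x \in Y :\: cj) = (x \notin cj) && (x \notin ci).
  by move=> xX; rewrite in_setD mY.
rewrite !mYj // !mX' // !mY //.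
have same (c : {set 'I_n}) x0 : c = [set x in X | a x == a x0] -> i \in c -> j \notin c.
  move=> ->; rewrite !inE iX' jX' /= => /eqP e; apply/eqP => e'; apply: naij.
  by rewrite e e'.
have [ii|ii] := boolP (i \in ci).
  by have ji := same ci i0 erefl ii; rewrite (negPf ji) (dij i ii) /= ?andbF ?addr0 ?add0r.
have [ji|ji] := boolP (j \in ci); first by rewrite (dij j ji) /= ?andbF ?addr0 ?add0r.
have [ij|ij] := boolP (i \in cj).
  by have jj := same cj j0 erefl ij; rewrite (negPf jj) /= ?andbF ?addr0 ?add0r.
have [jj|jj] := boolP (j \in cj); first by rewrite /= ?andbF ?addr0 ?add0r.
rewrite /= !addr0 HL ?mX' ?ii ?ij ?ji ?jj //.
by rewrite !mxE subrK.
Qed.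

(** * Matrices built along a shallow tree *)

(** The index bounds the number of rank-one terms along a branch: a term supported on [X] costs one,
    a direct sum is free. *)
Inductive blockdec : nat -> {set 'I_n} -> 'M[F]_n -> Prop :=
| blockdec0 c X : (#|X| <= 1)%N -> blockdec c X 0
| blockdec_add c X A (u : 'cV[F]_n) (w : 'rV[F]_n) :
    (forall i, i \notin X -> u i 0 = 0) -> (forall j, j \notin X -> w 0 j = 0) ->
    blockdec c X A -> blockdec c.+1 X (A + u *m w)
| blockdec_sum c X1 X2 A1 A2 : [disjoint X1 & X2] ->
    blockdec c X1 A1 -> blockdec c X2 A2 -> blockdec c (X1 :|: X2) (A1 + A2).

Lemma blockdec_leq c c' X A : (c <= c')%N -> blockdec c X A -> blockdec c' X A.
Proof.
move=> /leP; elim=> // m _ IH /IH h.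
have <- : A + (0 : 'cV[F]_n) *m (0 : 'rV[F]_n) = A by rewrite mul0mx addr0.
by apply: blockdec_add => // k _; rewrite mxE.
Qed.

Lemma mulmx_sum_col_row m p q (U : 'M[F]_(m, p)) (W : 'M_(p, q)) :
  U *m W = \sum_k col k U *m row k W.
Proof.
apply/matrixP => i j; rewrite summxE mxE; apply: eq_bigr => k _.
by rewrite mxE big_ord1 !mxE.
Qed.

(** A rank factorisation of [L], masked to [X], provides [\rank L] rank-one terms supported on
    [X]. *)
Lemma blockdec_add_rank c g X A L : blockdec c X A -> (\rank L <= g)%N ->
  blockdec (c + g) X (A + blk X X L).
Proof.
move=> h le; apply: (@blockdec_leq (c + \rank L)); first by rewrite leq_add2l.
have -> : blk X X L = (cmask X *m col_base L) *m (row_base L *m cmask X).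
  by rewrite blkE -{1}(mulmx_base L) !mulmxA.
rewrite mulmx_sum_col_row.
move: (\rank L) (col_base L) (row_base L) => {le}m U W.
elim: m U W => [|m IH] U W; first by rewrite big_ord0 addr0 addn0.
pose U0 := \matrix_(i < n, k < m) U i (widen_ord (leqnSn m) k).
pose W0 := \matrix_(k < m, j < n) W (widen_ord (leqnSn m) k) j.
rewrite big_ord_recr /= addnS addrA; apply: blockdec_add.
- by move=> i iX; rewrite !mxE big1 // => j _; rewrite !mxE; case: eqVneq => [<-|_];
    rewrite ?(negPf iX) ?mulr0n mul0r.
- by move=> i iX; rewrite !mxE big1 // => j _; rewrite !mxE; case: eqVneq => [->|_];
    rewrite ?(negPf iX) ?mulr0n mulr0.
have := IH U0 W0; congr (blockdec _ _ (_ + _)); apply: eq_bigr => k _; congr (_ *m _).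
  by apply/matrixP => i j; rewrite !mxE; apply: eq_bigr => l _; rewrite !mxE.
by apply/matrixP => i j; rewrite !mxE; apply: eq_bigr => l _; rewrite !mxE.
Qed.

(** Clearing one level subtracts a matrix of rank at most [glr r]. It is paid for in rank-one terms
    and also raises the off-diagonal ranks at all lower levels. At the end a single diagonal entry
    remains, of rank at most 1. *)
Fixpoint bdepth (l r : nat) : nat :=
  if l is l'.+1 then bdepth l' (r + glr r) + glr r else 1.

Lemma blockdec_classes c X (a : 'I_n -> nat) A :
  {in X &, forall i j, a i <> a j -> A i j = 0} ->
  (forall k, blockdec c [set x in X | a x == k] (blk [set x in X | a x == k] [set x in X | a x == k] A)) ->
  blockdec c X (blk X X A).
Proof.
move=> off H.
have main (ks : seq nat) : blockdec c [set x in X | a x \in ks]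
    (blk [set x in X | a x \in ks] [set x in X | a x \in ks] A).
  elim: ks => [|k ks IH].
    have -> : [set x in X | a x \in [::]] = set0 by apply/setP => x; rewrite !inE andbF.
    have -> : blk set0 set0 A = 0 by apply/matrixP => i j; rewrite !mxE inE.
    by apply: blockdec0; rewrite cards0.
  have [kks|kks] := boolP (k \in ks).
    suff -> : [set x in X | a x \in k :: ks] = [set x in X | a x \in ks] by [].
    by apply/setP => x; rewrite !inE; case: eqVneq => // ->; rewrite kks.
  set X1 := [set x in X | a x == k]; set X2 := [set x in X | a x \in ks] in IH *.
  have -> : [set x in X | a x \in k :: ks] = X1 :|: X2.
    by apply/setP => x; rewrite !inE -andb_orr.
  have d12 x : x \in X1 -> x \in X2 = false.
    by rewrite !inE => /andP[_ /eqP ->]; rewrite (negPf kks) andbF.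
  have -> : blk (X1 :|: X2) (X1 :|: X2) A = blk X1 X1 A + blk X2 X2 A.
    have off2 i j : i \in X1 -> j \in X2 -> A i j = 0 /\ A j i = 0.
      rewrite !inE => /andP[iX /eqP ai] /andP[jX aj].
      have nij : a i <> a j by move=> e; move: aj; rewrite -e ai (negPf kks).
      by split; apply: off => // /esym.
    apply/matrixP => i j; rewrite !mxE !in_setU.
    have [i1|i1] := boolP (i \in X1); have [j1|j1] := boolP (j \in X1).
    - by rewrite (d12 i i1) /= addr0.
    - by rewrite (d12 i i1) /= addr0; case: ifP => // j2; case: (off2 i j).
    - by rewrite (d12 j j1) /= andbF andbT addr0; case: ifP => // i2; case: (off2 j i).
    - by rewrite /= add0r.
  have dj : [disjoint X1 & X2] by apply/pred0P => x /=; apply/negP => /andP[/d12 ->].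
  exact: blockdec_sum dj (H k) IH.
have := main [seq a x | x <- enum X].
suff -> : [set x in X | a x \in [seq a x | x <- enum X]] = X by [].
apply/setP => x; rewrite inE; have [xX|//] := boolP (x \in X).
by apply/mapP; exists x; rewrite ?mem_enum.
Qed.

Lemma layout_blockdec D (a : nat -> 'I_n -> nat) l i r X A :
  (forall j x y, a j.+1 x = a j.+1 y -> a j x = a j y) -> injective (a D) ->
  (l + i)%N = D -> {in X &, forall x y, a i x = a i y} ->
  (forall j Z, (i <= j < D)%N -> Z \subset X -> {in Z &, forall x y, a j x = a j y} ->
     saturated (a j.+1) X Z ->
     (\rank (blk Z (X :\: Z) A) <= r)%N /\ (\rank (blk (X :\: Z) Z A) <= r)%N) ->
  blockdec (bdepth l r) X (blk X X A).
Proof.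
move=> ref inj; elim: l i r X A => [|l IH] i r X A liD cst H.
  have X1 : (#|X| <= 1)%N.
    by apply/card_le1_eqP => x y xX yX; apply: inj; rewrite -liD add0n; apply: cst.
  have := @blockdec_add_rank 0 1 X 0 (blk X X A) (blockdec0 0 X1).
  rewrite blk_blk // add0r; apply; rewrite blkE.
  apply: leq_trans (mxrankM_maxr _ _) _; exact: leq_trans (rank_cmask_le X) X1.
have iD : (i <= i < D)%N by rewrite leqnn -liD; lia.
have [|L rL HL] := @block_low_rank r X (a i.+1) A.
  by move=> Z sZ sat; case: (H i Z iD sZ _ sat) => // x y /(subsetP sZ) xX /(subsetP sZ) yX; apply: cst.
have -> : blk X X A = blk X X (A - L) + blk X X L by rewrite -blkD subrK.
apply: (blockdec_add_rank _ rL); apply: (@blockdec_classes _ _ (a i.+1)).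
  by move=> x y xX yX nxy; rewrite !mxE HL // subrr.
move=> k; set Y := [set x in X | _].
have sY : Y \subset X by apply/subsetP => x; rewrite inE => /andP[].
have mY x : x \in Y -> a i.+1 x = k by rewrite inE => /andP[_ /eqP].
apply: (IH i.+1); first by rewrite -liD addnS.
  by move=> x y /mY -> /mY ->.
move=> j Z /andP[ij jD] sZ cZ sat.
have refle m x y : a (m + i.+1)%N x = a (m + i.+1)%N y -> a i.+1 x = a i.+1 y.
  by elim: m => // m IHm h; apply: IHm; apply: ref.
have ijD : (i <= j < D)%N by rewrite jD andbT ltnW.
have satX : saturated (a j.+1) X Z.
  move=> y z yZ zX e; apply: (sat y z) => //; rewrite inE zX -(mY y) ?(subsetP sZ) //=.
  apply/eqP/esym/(refle (j - i)%N).
  by have -> : (j - i + i.+1 = j.+1)%N by move: ij; clear; lia.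
have sub1 P Q : P \subset X -> Q \subset X -> (\rank (blk P Q A) <= r)%N ->
    (\rank (blk P Q (A - L)%R) <= r + glr r)%N.
  move=> sP sQ le; rewrite blkD; apply: leq_trans (rankD_le _ _) _.
  by apply: leq_add le _; apply: leq_trans (rank_blk _ _ _) _; rewrite mxrank_opp.
have sZX := subset_trans sZ sY.
have sYZ : Y :\: Z \subset X :\: Z by apply: setSD.
have sYX : Y :\: Z \subset X by apply: subset_trans (subsetDl _ _) sY.
have [h1 h2] := H j Z ijD sZX cZ satX.
split; apply: sub1 => //; [move: h1|move: h2]; apply: leq_trans; exact: rank_blkS.
Qed.

End Blocks.

(** * Vector matroids *)

Import VectorInternalTheory.
Section VectorMatroid.
Variables (F : fieldType) (E : finType).

Definition spn m (v : E -> 'rV[F]_m) (Z : {set E}) : 'M[F]_m :=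
  (\sum_(e in Z) <<v e>>)%MS.
Definition rkv m (v : E -> 'rV[F]_m) (Z : {set E}) : nat := \rank (spn v Z).

Lemma mem_spn m (v : E -> 'rV[F]_m) (Z : {set E}) e : e \in Z -> (v e <= spn v Z)%MS.
Proof. by move=> eZ; apply: (sumsmx_sup e) => //; rewrite genmxE. Qed.

Lemma spn_subP m p (v : E -> 'rV[F]_m) (Z : {set E}) (A : 'M_(p, m)) :
  reflect (forall e, e \in Z -> (v e <= A)%MS) (spn v Z <= A)%MS.
Proof.
apply: (iffP sumsmx_subP) => h e /h; by rewrite genmxE.
Qed.

Lemma spnU m (v : E -> 'rV[F]_m) (Z1 Z2 : {set E}) :
  (spn v (Z1 :|: Z2) :=: spn v Z1 + spn v Z2)%MS.
Proof.
apply/eqmxP/andP; split.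
  apply/spn_subP => e; rewrite inE => /orP[] h.
    by apply: submx_trans (addsmxSl _ _); apply: mem_spn.
  by apply: submx_trans (addsmxSr _ _); apply: mem_spn.
by rewrite addsmx_sub; apply/andP; split; apply/spn_subP => e h; apply: mem_spn;
  rewrite inE h ?orbT.
Qed.

Lemma spnS m (v : E -> 'rV[F]_m) (Z1 Z2 : {set E}) :
  Z1 \subset Z2 -> (spn v Z1 <= spn v Z2)%MS.
Proof. by move=> /subsetP s; apply/spn_subP => e /s; apply: mem_spn. Qed.

Lemma rkv_axioms m (v : E -> 'rV[F]_m) : rank_axioms (rkv v).
Proof.
split=> [X|X Y sXY|X Y].
- rewrite -sum1_card; apply: (big_ind2 (fun (L : 'M[F]_m) k => \rank L <= k)%N).
  + by rewrite mxrank0.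
  + move=> L1 m1 L2 m2 h1 h2; apply: leq_trans (leq_add h1 h2).
    exact: (mxrank_adds_leqif L1 L2).1.
  + by move=> e _; rewrite genmxE rank_leq_row.
- exact/mxrankS/spnS.
rewrite /rkv (spnU v X Y) -(mxrank_sum_cap (spn v X)) leq_add2l; apply: mxrankS.
by rewrite sub_capmx !spnS ?subsetIl ?subsetIr.
Qed.

Lemma spnM m p (v : E -> 'rV[F]_m) (P : 'M_(m, p)) Z :
  (spn v Z *m P :=: spn (fun e => v e *m P) Z)%MS.
Proof.
apply: eqmx_trans (sumsmxMr_gen _ _ _) (eqmx_sums _) => e _.
by apply/eqmxP; rewrite !genmxE !(eqmxMr _ (genmxE _)) submx_refl.
Qed.

Lemma rkv_free m p (v : E -> 'rV[F]_m) (P : 'M_(m, p)) Z : row_free P ->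
  rkv (fun e => v e *m P) Z = rkv v Z.
Proof. by move=> fP; rewrite /rkv -(spnM v P Z) mxrankMfree. Qed.

Lemma eq_rkv m (v v' : E -> 'rV[F]_m) (Z : {set E}) : {in Z, v =1 v'} -> rkv v Z = rkv v' Z.
Proof. by move=> h; rewrite /rkv /spn; congr (\rank _); apply: eq_bigr => e /h ->. Qed.

(** A vector in both spans is at once fixed and killed by [P], hence zero. *)
Lemma rkv_sep m (v : E -> 'rV[F]_m) (P : 'M_m) (Z1 Z2 : {set E}) :
  {in Z1, forall e, v e *m P = v e} -> {in Z2, forall e, v e *m P = 0} ->
  rkv v (Z1 :|: Z2) = (rkv v Z1 + rkv v Z2)%N.
Proof.
move=> h1 h2; rewrite /rkv (spnU v Z1 Z2) mxrank_disjoint_sum //.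
apply/eqP/rowV0P => x; rewrite sub_capmx => /andP[x1 x2].
have s1 : (spn v Z1 <= kermx (P - 1%:M))%MS.
  by apply/spn_subP => e /h1 he; apply/sub_kermxP; rewrite mulmxBr mulmx1 he subrr.
have s2 : (spn v Z2 <= kermx P)%MS by apply/spn_subP => e /h2 he; apply/sub_kermxP.
have /sub_kermxP := submx_trans x1 s1; have /sub_kermxP := submx_trans x2 s2.
by rewrite mulmxBr mulmx1 => -> /eqP; rewrite sub0r oppr_eq0 => /eqP.
Qed.

(** The kernel of [P] is the span of [C], so applying [P] realises the contraction of [C]. *)
Lemma rkv_quot m p (v : E -> 'rV[F]_m) (P : 'M_(m, p)) Z (C : {set E}) :
  {in C, forall e, v e *m P = 0} -> (kermx P <= spn v C)%MS ->
  rkv v (Z :|: C) = (rkv (fun e => v e *m P) Z + rkv v C)%N.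
Proof.
move=> hC sC; rewrite {1}/rkv -(mxrank_mul_ker _ P).
have sCk : (spn v C <= kermx P)%MS.
  by apply/spn_subP => e eC; apply/sub_kermxP; apply: hC.
congr (_ + _)%N.
  rewrite (spnM v P _) (spnU (fun e => v e *m P) Z C) /rkv.
  suff -> : spn (fun e => v e *m P) C = 0 by rewrite addsmx0.
  by apply/eqP; rewrite -submx0; apply/spn_subP => e /hC ->; apply: sub0mx.
apply/eqP; rewrite eqn_leq; apply/andP; split; apply: mxrankS.
  exact: submx_trans (capmxSr _ _) sC.
by rewrite sub_capmx sCk spnS ?subsetUr.
Qed.

Lemma rkv_dim m (v : E -> 'rV[F]_m) (Z : {set E}) :
  rkv v Z = \dim <<[seq v x | x <- enum Z]>>%VS.
Proof.
have h (s : seq 'rV[F]_m) :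
    (vs2mx <<s>>%VS :=: \sum_(x <- s) <<(v2r x : 'rV_(dim 'rV[F]_m))>>)%MS.
  elim: s => [|x s IH]; first by rewrite span_nil big_nil; apply: eqmx_trans (mx2vsK _) _; rewrite linear0; apply: eqmx0.
  rewrite span_cons big_cons; apply: eqmx_trans (mx2vsK _) _.
  by apply: adds_eqmx IH; apply: eqmx_trans (mx2vsK _) (eqmx_sym (genmxE _)).
rewrite /dimv (h _) big_map big_enum_cond /=.
have fr : row_free (lin1_mx (@v2r F 'rV[F]_m)).
  apply: inj_row_free => u; rewrite mul_rV_lin1 /= => /eqP.
  by rewrite -(linear0 (@v2r F 'rV[F]_m)) (can_eq v2rK) => /eqP.
rewrite -(rkv_free v Z fr) /rkv /spn.
congr (\rank _); apply: eq_big => [e|e _]; first by rewrite andbT.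
by rewrite mul_rV_lin1.
Qed.

End VectorMatroid.

(** * Fundamental matrices *)

Lemma basis_form (F : fieldType) n m (v : 'I_n -> 'rV[F]_m) :
  exists (B : {set 'I_n}) (A : 'M[F]_n), A = blk (~: B) B A /\
    forall X, rkv v X = rkv (fun t => row t (cmask F B + A)) X.
Proof.
pose V := \matrix_t v t; pose f := maxrankfun V; pose Vf := rowsub f V.
have injf : injective f by exact: maxrankfun_inj.
have frV : row_free Vf by exact: maxrowsub_free.
pose C := V *m pinvmx Vf.
have VC : C *m Vf = V by apply: mulmxKpV; rewrite eq_maxrowsub.
(* [Q] moves the [i]-th coordinate with respect to the basis [Vf] to column [f i], so each basis
   element becomes the unit vector at its own index. *)
pose Q : 'M[F]_(\rank V, n) := \matrix_(i, j) (f i == j)%:R.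
have frQ : row_free Q.
  apply/row_freeP; exists Q^T; apply/matrixP => i j; rewrite !mxE.
  rewrite (bigD1 (f i)) //= big1 ?addr0 => [|k nk]; last by rewrite !mxE eq_sym (negPf nk) mul0r.
  by rewrite !mxE eqxx mul1r (inj_eq injf) eq_sym.
pose B := [set t | t \in codom f]; pose W := C *m Q.
have Cf j : row (f j) C = delta_mx 0 j.
  apply: (row_free_inj frV); rewrite -row_mul VC -rowE.
  by apply/rowP => k; rewrite !mxE.
have WN t s : s \notin B -> W t s = 0.
  rewrite inE => sB; rewrite mxE big1 // => i _; rewrite !mxE.
  by case: eqP => [e|]; [rewrite -e codom_f in sB|rewrite mulr0].
have Wf t i : W t (f i) = C t i.
  rewrite mxE (bigD1 i) //= big1 ?addr0 => [|k nk]; rewrite !mxE ?eqxx ?mulr1 //.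
  by rewrite (inj_eq injf) (negPf nk) mulr0.
exists B, (blk (~: B) B W); split; first by rewrite blk_blk.
have WE : cmask F B + blk (~: B) B W = W.
  apply/matrixP => t s; rewrite [LHS]mxE [blk _ _ _ _ _]mxE [cmask _ _ _ _]mxE.
  rewrite [(\row_j _) _ _]mxE !inE.
  have [/codomP[i ->]|sB] := boolP (s \in codom f); last first.
    by rewrite andbF addr0 WN ?inE //; case: eqVneq => // ->; rewrite (negPf sB).
  rewrite andbT Wf; have [/codomP[j ->]|tB] := boolP (t \in codom f).
    move/rowP: (Cf j) => /(_ i); rewrite !mxE => ->.
    by rewrite addr0 (inj_eq injf) eqxx /= eq_sym.
  by rewrite /= mul0rn add0r.
move=> X; rewrite WE.
have -> : rkv v X = rkv (fun t => row t C *m Vf) X.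
  by apply: eq_rkv => t _; rewrite -row_mul VC rowK.
rewrite rkv_free // -(rkv_free (fun t => row t C) X frQ).
by apply: eq_rkv => t _; rewrite -row_mul.
Qed.

(** The lower bounds for [Z] and its complement are added; subtracting the total rank, at most
    [#|B|], leaves the ranks of the two off-diagonal blocks. *)
Lemma basis_lambda (F : fieldType) n (B Z : {set 'I_n}) (A : 'M[F]_n) :
  A = blk (~: B) B A ->
  (\rank (blk Z (~: Z) A) <= lambda (rkv (fun t => row t (cmask F B + A))) Z (~: Z))%N.
Proof.
move=> AE; set v := fun t => _.
have A0 t s : (t \in B) || (s \notin B) -> A t s = 0.
  by move=> h; rewrite AE mxE inE -[s \in B]negbK -negb_or h.
have vB t : t \in B -> v t = delta_mx 0 t.
  move=> tB; apply/rowP => s; rewrite !mxE A0 ?tB // addr0 eqxx /= [s == t]eq_sym.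
  by case: (t == s).
have vN t : t \notin B -> v t = row t A.
  by move=> tB; apply/rowP => s; rewrite !mxE (negPf tB) mul0rn add0r.
(* The span of [Y] contains the unit vectors of [B :&: Y] and, modulo these, the rows of the block.
   The former live on columns in [Y] and the latter on columns outside, so the ranks add up. *)
have main (Y : {set 'I_n}) : (#|B :&: Y| + \rank (blk Y (~: Y) A) <= rkv v Y)%N.
  have cE : (cmask F (B :&: Y) <= spn v Y)%MS.
    apply/row_subP => t; have [tBY|tBY] := boolP (t \in B :&: Y); last first.
      suff -> : row t (cmask F (B :&: Y)) = 0 by apply: sub0mx.
      by apply/rowP => s; rewrite !mxE (negPf tBY) mul0rn.
    have /andP[tB tY] : (t \in B) && (t \in Y) by rewrite inE in tBY.
    suff -> : row t (cmask F (B :&: Y)) = v t by apply: mem_spn.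
    rewrite vB //; apply/rowP => s; rewrite !mxE tBY eqxx /= [s == t]eq_sym.
    by case: (t == s).
  have bE : (blk Y (~: Y) A <= spn v Y)%MS.
    apply/row_subP => t.
    have [tY|tY] := boolP (t \in Y); last first.
      suff -> : row t (blk Y (~: Y) A) = 0 by apply: sub0mx.
      by apply/rowP => s; rewrite !mxE (negPf tY).
    have [tB|tB] := boolP (t \in B).
      suff -> : row t (blk Y (~: Y) A) = 0 by apply: sub0mx.
      by apply/rowP => s; rewrite !mxE A0 ?tB //; case: ifP.
    have -> : row t (blk Y (~: Y) A) = v t - row t A *m cmask F (B :&: Y).
      rewrite vN //; apply/rowP => s; rewrite mul_mx_diag !mxE tY !inE.
      have [sB|sB] := boolP (s \in B); last by rewrite A0 ?sB ?orbT // mul0r subr0; case: ifP.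
      by case: (s \in Y); rewrite /= ?mulr1 ?mulr0 ?subrr ?subr0.
    apply: addmx_sub; first exact: mem_spn.
    by rewrite eqmx_opp; apply: submx_trans cE; apply: submxMl.
  rewrite -(rank_cmask F (B :&: Y)) -mxrank_disjoint_sum; first by apply: mxrankS; rewrite addsmx_sub cE bE.
  apply/eqP/rowV0P => x; rewrite sub_capmx => /andP[/submxP[D1 e1] /submxP[D2 e2]].
  have e3 : cmask F (B :&: Y) *m cmask F Y = cmask F (B :&: Y).
    apply/matrixP => i j; rewrite mul_mx_diag !mxE !inE.
    by case: eqVneq => [->|]; [case: (j \in B); case: (j \in Y)|]; rewrite /= ?mulr1 ?mulr0 ?mul0r.
  have e4 : blk Y (~: Y) A *m cmask F Y = 0.
    apply/matrixP => i j; rewrite mul_mx_diag !mxE !inE.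
    by case: (j \in Y); rewrite /= ?andbF ?mul0r ?mulr0.
  by rewrite e1 -e3 mulmxA -e1 e2 -mulmxA e4 mulmx0.
have hT : (rkv v setT <= #|B|)%N.
  rewrite -(rank_cmask F B); apply: mxrankS; apply/spn_subP => t _.
  have -> : v t = v t *m cmask F B; last exact: submxMl.
  rewrite /v; apply/rowP => s; rewrite mul_mx_diag !mxE.
  have [sB|sB] := boolP (s \in B); first by rewrite mulr1.
  by rewrite A0 ?sB ?orbT // mulr0 addr0; case: eqVneq => // ->; rewrite (negPf sB).
have h1 := main Z; have h2 := main (~: Z); have h3 := cardsID Z B.
rewrite -setDE in h2; rewrite /lambda setUCr.
move: h1 h2 h3 hT; move: (\rank _) (\rank _) (rkv v _) (rkv v _) (rkv v _).
by move: #|_| #|_| #|_|; clear; lia.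
Qed.

(** * Naming the rank-one terms *)

Section RankOneDecomposition.
Variables (F : fieldType) (n : nat) (K : finType).
Variables (u w : K -> 'I_n -> F).

(** [blockdec] with its terms named: [Y] lists the terms used on [X], each of which will become a
    coordinate. *)
Inductive rankonedec : nat -> {set 'I_n} -> {set K} -> Prop :=
| rankonedec0 c (X : {set 'I_n}) : (#|X| <= 1)%N -> rankonedec c X set0
| rankonedec_add c (X : {set 'I_n}) (Y : {set K}) k : k \notin Y ->
    (forall i, i \notin X -> u k i = 0) -> (forall j, j \notin X -> w k j = 0) ->
    rankonedec c X Y -> rankonedec c.+1 X (k |: Y)
| rankonedec_sum c (X1 X2 : {set 'I_n}) (Y1 Y2 : {set K}) : [disjoint X1 & X2] -> [disjoint Y1 & Y2] ->
    rankonedec c X1 Y1 -> rankonedec c X2 Y2 -> rankonedec c (X1 :|: X2) (Y1 :|: Y2).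

Lemma rankonedec_supp c (X : {set 'I_n}) (Y : {set K}) k i : rankonedec c X Y -> k \in Y -> i \notin X ->
  u k i = 0 /\ w k i = 0.
Proof.
move=> h; elim: h i => [? ? ? i|? {}X {}Y k' _ hu hw _ IH i|? X1 X2 Y1 Y2 _ _ _ IH1 _ IH2 i].
- by rewrite inE.
- by rewrite !inE => /orP[/eqP->|kY] iX; [split; [exact: hu|exact: hw]|exact: IH].
- rewrite !inE negb_or => /orP[kY|kY] /andP[i1 i2]; [exact: IH1|exact: IH2].
Qed.

End RankOneDecomposition.

Lemma rankonedec_inj (F : fieldType) n (K K' : finType) (f : K -> K')
    (u w : K' -> 'I_n -> F) c X Y : injective f ->
  rankonedec (fun k => u (f k)) (fun k => w (f k)) c X Y ->
  rankonedec u w c X (f @: Y).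
Proof.
move=> inj; elim=> {c X Y}.
- by move=> c X X1; rewrite imset0; apply: rankonedec0.
- move=> c X Y k kY hu hw _ IH; rewrite imsetU1.
  by apply: rankonedec_add => //; rewrite mem_imset.
- move=> c X1 X2 Y1 Y2 dX dY _ IH1 _ IH2; rewrite imsetU.
  by apply: rankonedec_sum => //; rewrite imset_disjoint.
Qed.

(** The index type follows the derivation: [void] at a leaf, [option] for a new term, a sum type for
    a direct sum. *)
Lemma blockdec_rankone (F : fieldType) n c X (A : 'M[F]_n) : blockdec c X A ->
  exists (K : finType) (u w : K -> 'I_n -> F),
    rankonedec u w c X setT /\ forall i j, A i j = \sum_k u k i * w k j.
Proof.
elim=> {c X A}.
- move=> c X X1; exists void, (fun (k : void) _ => match k with end), (fun (k : void) _ => match k with end).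
  split.
    have -> : [set: void] = set0 by apply/setP => -[].
    exact: rankonedec0.
  by move=> i j; rewrite mxE big1 // => -[].
- move=> c X A u0 w0 hu hw _ [K [u [w [dec AE]]]].
  pose u' k i := if k is Some k' then u k' i else u0 i 0.
  pose w' k j := if k is Some k' then w k' j else w0 0 j.
  have injS : injective (@Some K) by move=> ? ? [].
  exists (option K), u', w'; split.
    have -> : [set: option K] = None |: (Some @: [set: K]).
      by apply/setP => -[k|]; rewrite !inE //= mem_imset ?inE.
    apply: rankonedec_add; [by apply/imsetP => -[]|exact: hu|exact: hw|].
    exact: (rankonedec_inj (u := u') (w := w') injS dec).
  move=> i j; rewrite !mxE big_ord1 AE addrC.
  rewrite (bigD1 None) //=; congr (_ + _).
  rewrite (reindex_omap (@Some K) id) /=; last by case.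
  by apply: eq_bigl => k; rewrite eqxx.
- move=> c X1 X2 A1 A2 dX _ [K1 [u1 [w1 [dec1 AE1]]]] _ [K2 [u2 [w2 [dec2 AE2]]]].
  pose u k := match k with inl k => u1 k | inr k => u2 k end.
  pose w k := match k with inl k => w1 k | inr k => w2 k end.
  have inj1 : injective (@inl K1 K2) by move=> ? ? [].
  have inj2 : injective (@inr K1 K2) by move=> ? ? [].
  exists (K1 + K2)%type, u, w; split.
    have -> : [set: K1 + K2] = (inl @: [set: K1]) :|: (inr @: [set: K2]).
      by apply/setP => -[k|k]; rewrite !inE mem_imset ?inE ?orbT.
    apply: rankonedec_sum => //.
    + by apply/pred0P => k /=; apply/negP => /andP[/imsetP[k1 _ ->] /imsetP[]].
    + exact: (rankonedec_inj (u := u) (w := w) inj1 dec1).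
    + exact: (rankonedec_inj (u := u) (w := w) inj2 dec2).
  by move=> i j; rewrite mxE AE1 AE2 big_sumType.
Qed.

Section CoordinateVectors.
Variables (F : fieldType) (I : finType).

Definition vec (g : I -> F) : 'rV[F]_#|I| := \row_j g (enum_val j).
Definition imask (Q : pred I) : 'M[F]_#|I| := diag_mx (\row_j (Q (enum_val j))%:R).

Definition evec (i : I) : 'rV[F]_#|I| := vec (fun j => (j == i)%:R).

Lemma eq_vec g g' : g =1 g' -> vec g = vec g'.
Proof. by move=> h; apply/rowP => j; rewrite !mxE h. Qed.

Lemma vec_imask g Q : vec g *m imask Q = vec (fun j => if Q j then g j else 0).
Proof.
apply/rowP => j; rewrite mul_mx_diag !mxE.
by case: (Q _); rewrite ?mulr1 ?mulr0.
Qed.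

Lemma vec_eta (x : 'rV[F]_#|I|) : x = vec (fun j => x 0 (enum_rank j)).
Proof. by apply/rowP => j; rewrite mxE enum_valK. Qed.

Lemma ker_imask1 i0 : (kermx (imask (predC1 i0)) <= evec i0)%MS.
Proof.
apply/rV_subP => x /sub_kermxP; rewrite (vec_eta x) vec_imask => /rowP h.
suff -> : vec (fun j => x 0 (enum_rank j)) = x 0 (enum_rank i0) *: evec i0.
  exact: scalemx_sub.
apply/rowP => j; rewrite !mxE; have := h j; rewrite !mxE /=.
by case: eqVneq => [->|_] /=; rewrite ?mulr1 ?mulr0.
Qed.

End CoordinateVectors.

(* A matrix [A t s = \sum_k u k t * w k s] turns the matroid with basis [B] and
   fundamental matrix [A] into a minor of the matroid of the vectors [hvec]:
   contracting the elements [inr (inr k)] identifies the k-th new coordinate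
   with the vector [w k]. *)
Section Realization.
Variables (F : fieldType) (n : nat) (K : finType) (B : {set 'I_n}).
Variables (u w : K -> 'I_n -> F).
Let I : finType := ('I_n + K)%type.
Let E : finType := ('I_n + (K + K))%type.

Definition hvec (e : E) (j : I) : F :=
  match e, j with
  | inl t, inl s => ((t \in B) && (t == s))%:R
  | inl t, inr k => if t \in B then 0 else u k t
  | inr (inl _), inl _ => 0
  | inr (inl k), inr l => (k == l)%:R
  | inr (inr k), inl s => w k s
  | inr (inr k), inr l => - (k == l)%:R
  end.

(* The coordinates in [K] outside [Y] are contracted away. *)
Definition hvecY (Y : {set K}) (e : E) (j : I) : F :=
  match j with inl s => hvec e j | inr k => if k \in Y then hvec e j else 0 end.

Definition rkY (Y : {set K}) : {set E} -> nat := rkv (fun e => vec (hvecY Y e)).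

Definition ground (X : {set 'I_n}) (Y : {set K}) : {set E} :=
  [set e | match e with
           | inl t => t \in X
           | inr (inl k) => k \in Y
           | inr (inr k) => k \in Y
           end].

Lemma groundP X Y (e : E) : (e \in ground X Y) =
  match e with inl t => t \in X | inr (inl k) => k \in Y | inr (inr k) => k \in Y end.
Proof. by rewrite inE. Qed.

(** [inr (inl k)] is the unit vector of coordinate [k], so contracting it erases that coordinate. *)
Lemma rkY_contract (Y : {set K}) k : k \notin Y ->
  contract (rkY (k |: Y)) (inr (inl k)) =1 rkY Y.
Proof.
move=> kY Z; rewrite /contract /rkY.
rewrite (rkv_quot (P := imask F (predC1 (inr k : I)))); last first.
- apply: submx_trans (ker_imask1 F (inr k : I)) _.
  suff -> : evec F (inr k : I) = vec (hvecY (k |: Y) (inr (inl k))).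
    by apply: mem_spn; rewrite inE.
  apply: eq_vec => -[s|l] //=; rewrite !inE [k == l]eq_sym.
  have -> : (inr l == inr k :> I) = (l == k) by [].
  by case: (l == k) => //=; case: ifP.
- move=> e; rewrite inE => /eqP ->; rewrite vec_imask.
  apply/rowP => j; rewrite !mxE; case: (enum_val j) => [s|l] //=.
  have -> : (inr l == inr k :> I) = (l == k) by [].
  by case: eqVneq => //= _; rewrite if_same.
rewrite addnK; apply: eq_rkv => e _; rewrite vec_imask; apply: eq_vec => -[s|l] //=.
have -> : (inr l == inr k :> I) = (l == k) by [].
by rewrite !inE; case: eqVneq => //= ->; rewrite (negPf kY).
Qed.

(** Each rank-one term costs one contraction and one deletion, whence the factor 2; the additional 1
    pays for a single element at a leaf. *)
Lemma rankonedec_cdd c X Y : rankonedec u w c X Y ->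
  cdd_comps (rkY Y) (ground X Y) (2 * c).+1.
Proof.
elim=> {c X Y}.
- move=> c X X1 C C0 hC _; have sC := sep_sub hC.
  case/set0Pn: C0 => e eC; apply: (@cdd_single _ _ _ _ e) => //.
  apply/eqP; rewrite eqEsubset sub1set eC andbT; apply/subsetP => e' eC'.
  have := subsetP sC e eC; have := subsetP sC e' eC'; rewrite !groundP inE.
  case: e' eC' => [t'|[k'|k']] _; rewrite ?inE //; case: e eC => [t|[k|k]] _; rewrite ?inE // => tX tX'.
  by apply/eqP; congr inl; move/card_le1_eqP: X1; apply.
- move=> c X Y k kY hu hw _ IH; rewrite mulnS addSn addSn add0n.
  have rax := rkv_axioms (fun e => vec (hvecY (k |: Y) e)).
  apply: (@cdd_comps_contract _ _ _ (inr (inl k))) => //.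
    by rewrite groundP !inE eqxx.
  apply: (@cdd_comps_delete _ _ _ (inr (inr k))); first exact: contract_rank_axioms.
    by rewrite !inE eqxx.
  have -> : ground X (k |: Y) :\ inr (inl k) :\ inr (inr k) = ground X Y.
    apply/setP => -[t|[l|l]]; rewrite !inE //=.
      have -> : (inr (inl l) == inr (inl k) :> E) = (l == k) by [].
      by case: eqVneq => [->|] //=; rewrite (negPf kY).
    have -> : (inr (inr l) == inr (inr k) :> E) = (l == k) by [].
    by case: eqVneq => [->|] //=; rewrite (negPf kY).
  by apply: eq_cdd_comps IH => Z _; rewrite rkY_contract.
- move=> c X1 X2 Y1 Y2 dX dY h1 IH1 h2 IH2.
  have gU : ground (X1 :|: X2) (Y1 :|: Y2) = ground X1 Y1 :|: ground X2 Y2.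
    by apply/setP => -[t|[l|l]]; rewrite !inE.
  (* Elements of one part vanish on the new coordinates of the other: [u l] is supported in the part
     of [l], and a new element touches only its own index in [K]. *)
  have restr (Xa Xb : {set 'I_n}) (Ya Yb : {set K}) ca :
      [disjoint Xa & Xb] -> [disjoint Ya & Yb] -> rankonedec u w ca Xb Yb ->
      {in ground Xa Ya, forall e, hvecY (Ya :|: Yb) e =1 hvecY Ya e}.
    move=> dXab dYab hb e; rewrite groundP => eg [s|l] //=; rewrite inE.
    have [//|la] := boolP (l \in Ya); case: ifP => //= lb.
    case: e eg => [t|[k|k]] //= eg.
    + case: ifP => // _; have tb : t \notin Xb by rewrite (disjointFr dXab eg).
      by case: (rankonedec_supp hb lb tb).
    + by case: eqVneq => // kl; rewrite -kl eg in la.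
    + by case: eqVneq => [kl|_]; [rewrite -kl eg in la|rewrite oppr0].
  have dX' : [disjoint X2 & X1] by rewrite disjoint_sym.
  have dY' : [disjoint Y2 & Y1] by rewrite disjoint_sym.
  have r1 := restr _ _ _ _ _ dX dY h2; have r2 := restr _ _ _ _ _ dX' dY' h1.
  rewrite (setUC Y2) in r2.
  have rax := rkv_axioms (fun e => vec (hvecY (Y1 :|: Y2) e)).
  (* The projection onto the coordinates of the first part fixes the vectors of that part and kills
     those of the other. *)
  pose Q (j : I) := match j with inl s => s \in X1 | inr l => l \in Y1 end.
  rewrite gU; apply: cdd_comps_union => //.
  + apply: sep_le => //; first exact: subsetUl.
    have -> : (ground X1 Y1 :|: ground X2 Y2) :\: ground X1 Y1 = ground X2 Y2.
      apply/setP => -[t|[l|l]]; rewrite !inE.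
      * by case: (boolP (t \in X1)) => //= /(disjointFr dX) ->.
      * by case: (boolP (l \in Y1)) => //= /(disjointFr dY) ->.
      * by case: (boolP (l \in Y1)) => //= /(disjointFr dY) ->.
    rewrite /rkY (rkv_sep (P := imask F Q)) //.
      move=> e eg; rewrite vec_imask; apply: eq_vec => j; case: ifP => // Qj.
      rewrite (r1 e eg); move: eg; rewrite groundP.
      case: j Qj => [s|l] /= Qj; last by rewrite Qj.
      case: e => [t|[k|k]] //= eg.
        by case: eqVneq => [ts|_]; [rewrite -ts eg in Qj|rewrite andbF].
      by have [_ ->] := rankonedec_supp h1 eg (negbT Qj).
    move=> e eg; rewrite vec_imask; apply/rowP => j; rewrite !mxE; case: ifP => // Qj.
    rewrite (r2 e eg); move: eg Qj; rewrite groundP.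
    case: (enum_val j) => [s|l] /= eg Qj; last by rewrite (disjointFr dY Qj).
    case: e eg => [t|[k|k]] //= eg.
      by case: eqVneq => [ts|_]; [rewrite ts (disjointFr dX Qj) in eg|rewrite andbF].
    have sX2 : s \notin X2 by rewrite (disjointFr dX Qj).
    by have [_ ->] := rankonedec_supp h2 eg sX2.
  + apply: eq_cdd_comps IH1 => Z sZ; apply: eq_rkv => e eZ; apply: eq_vec => j.
    by rewrite r1 ?(subsetP sZ).
  + apply: eq_cdd_comps IH2 => Z sZ; apply: eq_rkv => e eZ; apply: eq_vec => j.
    by rewrite r2 ?(subsetP sZ).
Qed.

Definition realization : matroid :=
  Matroid (rkv_axioms (fun e : E => vec (hvec e))).

Lemma realization_cdd c : (0 < n)%N -> rankonedec u w c setT setT ->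
  cdd_at_most realization (2 * c).+1.
Proof.
move=> n0 dec; apply: cdd_comps_cdd; first exact: rkv_axioms.
  by apply/set0Pn; exists (inl (Ordinal n0)); rewrite inE.
have := rankonedec_cdd dec.
have -> : ground setT setT = setT by apply/setP => -[t|[k|k]]; rewrite !inE.
apply: eq_cdd_comps => Z _; apply: eq_rkv => e _; apply: eq_vec => -[s|l] //=.
by rewrite inE.
Qed.

Lemma realization_minor (A : 'M[F]_n) (X : {set 'I_n}) :
  A = blk (~: B) B A -> (forall i j, A i j = \sum_k u k i * w k j) ->
  let C : {set elt realization} := [set e | if e is inr (inr k) then true else false] in
  rkv (fun t => row t (cmask F B + A)) X =
    (rk realization ((inl : 'I_n -> elt realization) @: X :|: C) - rk realization C)%N.
Proof.
move=> AE Auw C.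
(* The quotient map of the contraction: old coordinates stay, and the [k]-th new one is sent to
   [w k]. *)
pose P : 'M[F]_(#|I|, n) := \matrix_(j, s)
  match enum_val j with inl t => (t == s)%:R | inr k => w k s end.
have vecP (g : I -> F) s : (vec g *m P) 0 s = g (inl s) + \sum_k g (inr k) * w k s.
  rewrite mxE; under eq_bigr => j _ do rewrite !mxE.
  rewrite -(big_enum_val (A := I) (fun i : I => g i * match i with inl t => (t == s)%:R | inr k => w k s end)).
  rewrite big_sumType /=; congr (_ + _).
  rewrite (bigD1 s) //= big1 ?addr0 ?eqxx ?mulr1 // => t /negPf ->.
  by rewrite mulr0.
have A0 t s : (t \in B) || (s \notin B) -> A t s = 0.
  by move=> h; rewrite AE mxE inE -[s \in B]negbK -negb_or h.
have CE : {in C, forall e, vec (hvec e) *m P = 0}.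
  move=> [t|[k|k]]; rewrite inE // => _; apply/rowP => s; rewrite vecP mxE /=.
  rewrite (bigD1 k) //= big1 ?addr0 => [|l nl].
    by rewrite eqxx mulN1r subrr.
  by rewrite eq_sym (negPf nl) oppr0 mul0r.
rewrite /= (rkv_quot (P := P)) //; last first.
  apply/rV_subP => x /sub_kermxP xP; rewrite (vec_eta x) in xP *.
  set g := fun j => _ in xP *.
  (* The new coordinates of a kernel vector determine its old ones, and their negatives are the
     coefficients. *)
  have -> : vec g = \sum_k (- g (inr k)) *: vec (hvec (inr (inr k))).
    apply/rowP => j; rewrite mxE summxE; under eq_bigr => k _ do rewrite !mxE.
    case: (enum_val j) => [s|l] /=.
      have := vecP g s; rewrite xP mxE => /esym/eqP; rewrite addr_eq0 => /eqP ->.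
      by rewrite -sumrN; apply: eq_bigr => k _; rewrite mulNr.
    rewrite (bigD1 l) //= big1 ?addr0 => [|k /negPf nk]; first by rewrite eqxx mulrNN mulr1.
    by rewrite nk oppr0 mulr0.
  apply: summx_sub => k _; apply: scalemx_sub; apply: (mem_spn (fun e => vec (hvec e))).
  by rewrite inE.
rewrite addnK /rkv.
have eqm : (spn (fun t => row t (cmask F B + A)) X :=:
    spn (fun e : E => vec (hvec e) *m P) ((inl : 'I_n -> E) @: X))%MS.
  have vE t : vec (hvec (inl t)) *m P = row t (cmask F B + A).
    apply/rowP => s; rewrite vecP !mxE /=.
    case: (boolP (t \in B)) => tB /=; last by rewrite mul0rn !add0r Auw.
    rewrite A0 ?tB // addr0 big1 ?addr0 => [|k _]; last by rewrite mul0r.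
    by case: (t == s).
  apply/eqmxP/andP; split; apply/spn_subP => e.
    by move=> eX; rewrite -vE; apply: (mem_spn (fun e : E => vec (hvec e) *m P)); apply: imset_f.
  by case/imsetP => t tX ->; rewrite vE; apply: (mem_spn (fun t => row t (cmask F B + A))).
by rewrite eqm.
Qed.

End Realization.

(** * The two implications *)

Lemma layout_minor_cdd (F : fieldType) (M : matroid) D r : (0 < #|elt M|)%N ->
  representable F M -> layout (rk M) [set: elt M] D r ->
  exists N, [/\ representable F N, cdd_at_most N (2 * bdepth D r).+1 & is_minor M N].
Proof.
move=> n0 [m [v vE]] [a [a0 aS aD aw]].
pose n := #|elt M|; pose v' (i : 'I_n) := v (enum_val i).
have [B [A [AE rkE]]] := basis_form v'.
pose a' i (x : 'I_n) := a i (enum_val x).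
have rkM (X : {set 'I_n}) : rkv v' X = rk M [set enum_val x | x in X].
  rewrite vE -rkv_dim /rkv; suff h : (spn v' X :=: spn v [set enum_val x | x in X])%MS by rewrite h.
  apply/eqmxP/andP; split; apply/spn_subP => e.
    by move=> eX; apply: (mem_spn v); apply: imset_f.
  by case/imsetP => x xX ->; apply: (mem_spn v').
have dec : blockdec (bdepth D r) setT A.
  have -> : A = blk setT setT A by apply/matrixP => i j; rewrite !mxE !inE.
  apply: (@layout_blockdec _ _ D a' D 0).
  - by move=> j x y; apply: aS; rewrite inE.
  - by move=> x y e; apply: enum_val_inj; apply: aD e; rewrite inE.
  - by rewrite addn0.
  - by move=> x y _ _; apply: a0; rewrite inE.
  move=> j Z jD _ cZ sat; rewrite setTD.
  have le : (lambda (rkv v') Z (~: Z) <= r)%N.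
    pose Z' := [set enum_val x | x in Z].
    have ZC : [set: elt M] :\: Z' = [set enum_val x | x in ~: Z].
      apply/setP => x; rewrite -(enum_rankK x) mem_imset; last exact: enum_val_inj.
      by rewrite !inE mem_imset ?andbT //; apply: enum_val_inj.
    have -> : lambda (rkv v') Z (~: Z) = lambda (rk M) Z' ([set: elt M] :\: Z').
      by rewrite /lambda ZC !rkM imsetU.
    apply: (aw j) => //.
      by move=> _ _ /imsetP[x xZ ->] /imsetP[y yZ ->]; apply: cZ.
    move=> _ z /imsetP[x xZ ->] _ e; rewrite -(enum_rankK z); apply: imset_f.
    by apply: (sat x) => //; rewrite /a' enum_rankK.
  have lamE : lambda (rkv v') Z (~: Z) = lambda (rkv (fun t => row t (cmask F B + A))) Z (~: Z).
    by rewrite /lambda !rkE.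
  split; apply: leq_trans le; rewrite lamE; first exact: basis_lambda.
  by have := @basis_lambda _ _ _ (~: Z) _ AE; rewrite setCK lambdaC.
have [K [u [w [dec1 Auw]]]] := blockdec_rankone dec.
exists (realization B u w); split.
- by exists #|{: 'I_n + K}|, (fun e => vec (hvec B u w e)) => X; rewrite /= rkv_dim.
- exact: realization_cdd.
pose C : {set elt (realization B u w)} := [set e | if e is inr (inr k) then true else false].
exists (fun x => inl (enum_rank x)), C; split.
- by move=> x y [] /enum_rank_inj.
- by apply/pred0P => e /=; apply/negP => /andP[eC /imsetP[x _ ex]]; rewrite ex inE in eC.
move=> X; pose X' := [set enum_rank x | x in X].
have -> : [set inl (enum_rank x) | x in X] = (inl : 'I_n -> elt (realization B u w)) @: X'.
  by rewrite /X' -imset_comp.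
rewrite -(realization_minor X' AE Auw) -rkE rkM /X' -imset_comp.
congr (rk M _); apply/setP => x; apply/idP/imsetP => [xX|[y yX ->]].
  by exists x => //=; rewrite enum_rankK.
by rewrite /= enum_rankK.
Qed.

Local Close Scope ring_scope.

Theorem theorem1p1 (F : fieldType) (Mc : matroid -> Prop) :
  (forall M, Mc M -> representable F M) ->
  (forall M, Mc M -> 0 < #|elt M|) ->
  ((exists k : nat, forall M, Mc M -> bd_le M k) <->
   (exists (d : nat) (Nc : matroid -> Prop),
      (forall N, Nc N -> representable F N /\ cdd_at_most N d) /\
      (forall M, Mc M -> exists N, Nc N /\ is_minor M N))).
Proof.
move=> repM M0; split=> [[k bdM]|[d [Nc [cddN minN]]]].
  pose f D r := (2 * bdepth D r).+1.
  (* The maximum over all admissible pairs replaces a monotonicity argument for [bdepth]. The range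
     includes [k.+1] because the layout has depth [d.+1] and width [maxn r 1]. *)
  pose bound := \max_(D < k.+2) \max_(r < k.+2) f D r.
  exists bound, (fun N => representable F N /\ cdd_at_most N bound); split=> // M HM.
  have [d [r [dk rk_ dec]]] := bdM M HM.
  have lay := decomposition_layout dec.
  have [N [repN cddN minN]] := layout_minor_cdd (M0 M HM) (repM M HM) lay.
  exists N; split=> //; split=> //.
  have hd : d.+1 < k.+2 by [].
  have hr : maxn r 1 < k.+2 by rewrite ltnS geq_max ltnS andbT leqW.
  have le : f d.+1 (maxn r 1) <= bound.
    apply: leq_trans (leq_bigmax (F := fun D : 'I_k.+2 => \max_(r < k.+2) f D r) (Ordinal hd)).
    exact: (leq_bigmax (F := fun r : 'I_k.+2 => f d.+1 r) (Ordinal hr)).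
  move/leP: le cddN => le; elim: le => // m _ IH /IH; exact: cdd_leS.
exists d.+1 => M HM; have [N [NN min]] := minN M HM.
have [_ cdd] := cddN N NN.
have [lay _] := cdd_layout (rk_ax N) cdd.
have [D' leD dec] := layout_decomposition (M0 M HM) (layout_minor min lay).
by exists D', d; split.
Qed.
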